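(* (i) Let $m,n,p$ be positive integers, and let $s\in\mathbb C$ be such that $\frac{s+l}{n}+\frac{j}{m}\notin\{0,-1,-2,\dots\}$ for all $0\le l\le n-1$, $1\le j\le m$ (so that all terms below are well defined). Then $$\prod_{j=1}^{p}\Gamma\left(s+\frac{n}{m}j\right)=n^{-\frac p2+sp+\frac{np}{2m}(1+p)}(2\pi)^{-\frac{p(n-1)}{2}}\prod_{l=0}^{n-1}\prod_{j=1}^{m}\frac{G\left(\frac{s+l}{n}+\frac{j+p}{m}\right)}{G\left(\frac{s+l}{n}+\frac{j}{m}\right)} .$$ (ii) Let $p$ be a positive integer, and let $\beta>0$ be such that $\beta/2=m/n$ with $m,n$ relatively prime positive integers. Then $$\binom{2p}{p}\prod_{j=1}^{p}\frac{\Gamma\left(1+\frac{2j}{\beta}\right)}{\Gamma\left(1+\frac{2(j+p)}{\beta}\right)}=n^{-2p^2/\beta}\prod_{\nu=0}^{n-1}\prod_{\mu=0}^{m-1}\frac{G\left(\frac pm+\frac\nu n-\frac\mu m+1\right)^2}{G\left(\frac{2p}m+\frac\nu n-\frac\mu m+1\right)G\left(\frac\nu n-\frac\mu m+1\right)} .$$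
   Context: $\Gamma$ is the gamma function and $G$ is the Barnes $G$-function, i.e. the entire function with $G(1)=1$ satisfying $G(z+1)=\Gamma(z)G(z)$ (zeros exactly at $0,-1,-2,\dots$). *)

(* Defs.v *)
From HB Require Import structures.
From mathcomp Require Import all_boot all_order all_algebra.
From mathcomp Require Import complex.
From mathcomp Require Import all_classical all_reals all_analysis.

Set Implicit Arguments.
Unset Strict Implicit.
Unset Printing Implicit Defensive.

Import Order.TTheory GRing.Theory Num.Theory.
Import numFieldNormedType.Exports.

Local Open Scope classical_set_scope.
Local Open Scope ring_scope.
Local Open Scope complex_scope.

Section SpecialFunctions.
Context {R : realType}.

Definition cexp (z : R[i]) : R[i] :=
  (expR (complex.Re z))%:C * (cos (complex.Im z) +i* sin (complex.Im z)).

(* The principal power a ^ z; only meaningful for a > 0. *)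
Definition cpow (a : R) (z : R[i]) : R[i] := cexp (z * (ln a)%:C).

(* [^o] selects the topology that the modulus induces on R[i]. *)
Definition clim (u : nat -> R[i]) : R[i] :=
  lim ((u : nat -> (R[i])^o) @ \oo).

(* Euler's limit formula, valid for every z outside {0, -1, -2, ...}. *)
Definition Gamma (z : R[i]) : R[i] :=
  clim (fun N => N`!%:R * cpow N%:R z / \prod_(0 <= k < N.+1) (z + k%:R)).

Definition euler_gamma : R :=
  lim ((fun N => \sum_(1 <= k < N.+1) k%:R^-1 - ln N%:R : R^o) @ \oo).

(* The conditions G(1) = 1 and G(z + 1) = Gamma(z) G(z), even together with
   the location of the zeros, do not single out one entire function (multiply
   by exp(2 i pi z)), so Barnes's canonical product is used:
     G(1 + w) = (2 pi)^(w/2) exp(- (w + (1 + gamma) w^2) / 2)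
                * prod_(k >= 1) (1 + w/k)^k exp(w^2/(2k) - w). *)
Definition barnesG (z : R[i]) : R[i] :=
  let w := z - 1 in
  cpow (2 * pi) (w / 2)
  * cexp (- (w + (1 + euler_gamma%:C) * w ^+ 2) / 2)
  * clim (fun N => \prod_(1 <= k < N.+1)
        ((1 + w / k%:R) ^+ k * cexp (w ^+ 2 / (2 * k%:R) - w))).

End SpecialFunctions.

(* Main.v *)
(* From Euler's limit one gets Gamma (z + 1) = z Gamma z, and from Stirling's
   formula Gauss's multiplication formula for
   prod_(l < n) Gamma (z + l / n).  The canonical product gives
   G (z + 1) = Gamma z * G z; Stirling's constant is what normalizes it.
   In (i) the product over j of G (a + (j + p) / m) / G (a + j / m) telescopes,
   one shift of p at a time, to prod_(1 <= q <= p) Gamma (a + q / m); taking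
   a = (s + l) / n, the product over l is then a Gauss product for each q.
   Part (ii) follows from (i) at s = 0, for p and for 2 p, after the
   substitution j = m - mu. *)
Require Import Defs.
From mathcomp Require Import all_boot all_order all_algebra.
From mathcomp Require Import complex.
From mathcomp Require Import all_classical all_reals all_analysis.
From mathcomp Require Import ring lra.

Import Order.TTheory GRing.Theory Num.Theory.
Import numFieldNormedType.Exports.

Local Open Scope ring_scope.
Local Open Scope complex_scope.

(** [Gamma] and [barnesG] are defined by [lim], which denotes something even when the sequence
    diverges. They become usable only after a convergence proof, and quotients of their values only
    after a proof that the limits do not vanish. Complex logarithms are avoided: an infinite product
    is controlled through the distance of its factors to 1, which has to be [O(1 / k ^ 2)]. A factor
    of the canonical product of G is a k-th power, so its base must be within [O(1 / k ^ 3)] of 1;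
    this is why the exponential is expanded to second order with a cubic remainder. Each functional
    equation is first an exact identity between sequences at index N, up to auxiliary factors with
    known limits, and then follows by uniqueness of limits. In these identities factorials and
    powers of N become [cexp] of real logarithms, which leaves a ring identity between exponents. *)

Section GammaAndBarnes.
Local Open Scope classical_set_scope.
Set Implicit Arguments.
Unset Strict Implicit.
Local Notation cabs := ComplexField.Normc.normc.

(** * Taylor estimates *)

(** Lets an inequality be integrated from 0: every real Taylor bound below is obtained from a cruder
    one in this way. *)
Lemma ler_is_derive (R : realType) (f g : R -> R) (a : R) : 0 <= a ->
  (forall x, 0 <= x <= a -> is_derive x 1 f (g x)) ->
  (forall x, 0 <= x <= a -> 0 <= g x) -> f 0 <= f a.
Proof.
move=> a0 df g0; apply: (@ger0_derive1_le R f 0 a _ _ true false) => //.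
- by move=> x /[!in_itv]/= /andP[x0 xa]; have [] := df x; rewrite ?ltW.
- move=> x /[!in_itv]/= /andP[x0 xa]; have dx : 0 <= x <= a by rewrite !ltW.
  by rewrite derive1E; have [_ ->] := df x dx; exact: g0.
- apply: derivable_within_continuous => x; rewrite in_itv /= => xa.
  by have [] := df x xa.
- by rewrite in_itv /= lexx a0.
- by rewrite in_itv /= lexx a0.
Qed.

(** The tangent inequality at [- (x / 2)] gives [expR (- (x / 2)) >= 1 / 2], and [expR x] is the
    inverse of its square. *)
Lemma expR_le4 (R : realType) (x : R) : x <= 1 -> expR x <= 4.
Proof.
move=> x1; have h : 1 - x / 2 <= expR (- (x / 2)) by exact: expR_ge1Dx.
have e : expR x * expR (- (x / 2)) ^+ 2 = 1.
  by rewrite -expRM_natl -expRD -[RHS](@expR0 R); congr expR; field.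
have u2 : 4^-1 <= expR (- (x / 2)) ^+ 2 by nra.
have := expR_gt0 x; nra.
Qed.

(** For negative [x] the series alternates, and its partial sums bracket the exponential. On
    [[0, 1]] the bound [expR <= 4] is integrated three times; the resulting coefficient [4 / 6] of
    the cube is rounded up to 1. *)
Lemma expR_taylor2 (R : realType) (x : R) : `|x| <= 1 ->
  `|expR x - (1 + x + x ^+ 2 / 2)| <= `|x| ^+ 3.
Proof.
have [x0|x0] := leP 0 x => x1; last first.
  have -> : x = - (- x) by rewrite opprK.
  set y := - x; have y0 : 0 <= y by rewrite /y; lra.
  rewrite normrN (ger0_norm y0) => {x1}.
  have h1 t : 1 - t <= expR (- t) :> R by exact: expR_ge1Dx.
  have h2 (t : R) : 0 <= t -> expR (- t) <= 1 - t + t ^+ 2 / 2.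
    move=> t0; rewrite -subr_ge0.
    pose f (s : R) := 1 - s + s ^+ 2 / 2 - expR (- s).
    have f0 : f 0 = 0 by rewrite /f oppr0 expR0 expr0n /= mul0r !(addr0, subr0) subrr.
    have := @ler_is_derive R f (fun s => - 1 + s + expR (- s)) t t0.
    rewrite f0; apply.
      move=> s _; rewrite /f; apply: is_derive_eq.
      by rewrite /GRing.scale /=; field.
    by move=> s _; have := h1 s; lra.
  have h3 (t : R) : 0 <= t -> 1 - t + t ^+ 2 / 2 - t ^+ 3 / 6 <= expR (- t).
    move=> t0; rewrite -subr_ge0.
    pose f (s : R) := expR (- s) - (1 - s + s ^+ 2 / 2 - s ^+ 3 / 6).
    have f0 : f 0 = 0 by rewrite /f oppr0 expR0 !expr0n /= !mul0r !(addr0, subr0) subrr.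
    have := @ler_is_derive R f (fun s => (1 - s + s ^+ 2 / 2) - expR (- s)) t t0.
    rewrite f0; apply.
      move=> s _; rewrite /f; apply: is_derive_eq.
      by rewrite /GRing.scale /=; field.
    by move=> s /andP[s0 _]; have := h2 s s0; lra.
  have := h2 y y0; have := h3 y y0; have : 0 <= y ^+ 3 by exact: exprn_ge0.
  by clearbody y; rewrite ler_norml sqrrN => y3 *; apply/andP; split; lra.
rewrite (ger0_norm x0); rewrite (ger0_norm x0) in x1.
have g1 (t : R) : 0 <= t <= 1 -> expR t <= 1 + 4 * t.
  move=> /andP[t0 t1]; rewrite -subr_ge0.
  pose f (s : R) := 1 + 4 * s - expR s.
  have f0 : f 0 = 0 by rewrite /f expR0 mulr0 addr0 subrr.
  have := @ler_is_derive R f (fun s => 4 - expR s) t t0.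
  rewrite f0; apply.
    move=> s _; rewrite /f; apply: is_derive_eq.
    by rewrite /GRing.scale /=; field.
  move=> s /andP[s0 st]; rewrite subr_ge0 expR_le4 //; exact: le_trans st t1.
have g2 (t : R) : 0 <= t <= 1 -> expR t <= 1 + t + 2 * t ^+ 2.
  move=> /andP[t0 t1]; rewrite -subr_ge0.
  pose f (s : R) := 1 + s + 2 * s ^+ 2 - expR s.
  have f0 : f 0 = 0 by rewrite /f expR0 expr0n /= mulr0 !addr0 subrr.
  have := @ler_is_derive R f (fun s => 1 + 4 * s - expR s) t t0.
  rewrite f0; apply.
    move=> s _; rewrite /f; apply: is_derive_eq.
    by rewrite /GRing.scale /=; field.
  move=> s /andP[s0 st]; rewrite subr_ge0 g1 // s0; exact: le_trans st t1.
have g3 : expR x <= 1 + x + x ^+ 2 / 2 + x ^+ 3.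
  rewrite -subr_ge0.
  pose f (s : R) := 1 + s + s ^+ 2 / 2 + s ^+ 3 - expR s.
  have f0 : f 0 = 0 by rewrite /f expR0 !expr0n /= mul0r !addr0 subrr.
  have := @ler_is_derive R f (fun s => 1 + s + 3 * s ^+ 2 - expR s) x x0.
  rewrite f0; apply.
    move=> s _; rewrite /f; apply: is_derive_eq.
    by rewrite /GRing.scale /=; field.
  move=> s /andP[s0 st]; have : 0 <= s <= 1 by rewrite s0; exact: le_trans st x1.
  by move=> /g2; have := sqr_ge0 s; lra.
have h2 : 1 + x + x ^+ 2 / 2 <= expR x.
  rewrite -subr_ge0.
  pose f (s : R) := expR s - (1 + s + s ^+ 2 / 2).
  have f0 : f 0 = 0 by rewrite /f expR0 !expr0n /= mul0r !addr0 subrr.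
  have := @ler_is_derive R f (fun s => expR s - (1 + s)) x x0.
  rewrite f0; apply.
    move=> s _; rewrite /f; apply: is_derive_eq.
    by rewrite /GRing.scale /=; field.
  by move=> s _; rewrite subr_ge0 expR_ge1Dx.
have x3 : 0 <= x ^+ 3 by exact: exprn_ge0.
by rewrite ler_norml; apply/andP; split; lra.
Qed.

(** Four successive integrations of [cos <= 1] give the four bounds, alternately for sine and
    cosine. *)
Lemma cos_sin_taylor_pos (R : realType) (t : R) : 0 <= t ->
  [/\ 0 <= t - sin t, t - sin t <= t ^+ 3 / 6,
      0 <= cos t - (1 - t ^+ 2 / 2) & cos t - (1 - t ^+ 2 / 2) <= t ^+ 4 / 24].
Proof.
have s1 (u : R) : 0 <= u -> 0 <= u - sin u :> R.
  move=> u0; pose f (s : R) := s - sin s.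
  have f0 : f 0 = 0 by rewrite /f sin0 subrr.
  have := @ler_is_derive R f (fun s => 1 - cos s) u u0.
  rewrite f0; apply.
  by move=> s _; have := cos_le1 s; lra.
have c1 (u : R) : 0 <= u -> 0 <= cos u - (1 - u ^+ 2 / 2) :> R.
  move=> u0; pose f (s : R) := cos s - (1 - s ^+ 2 / 2).
  have f0 : f 0 = 0 by rewrite /f cos0 expr0n /= mul0r subr0 subrr.
  have := @ler_is_derive R f (fun s => s - sin s) u u0.
  rewrite f0; apply.
    move=> s _; rewrite /f; apply: is_derive_eq.
    by rewrite /GRing.scale /=; field.
  by move=> s /andP[s0 _]; exact: s1.
have s2 (u : R) : 0 <= u -> 0 <= u ^+ 3 / 6 - (u - sin u) :> R.
  move=> u0; pose f (s : R) := s ^+ 3 / 6 - (s - sin s).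
  have f0 : f 0 = 0 by rewrite /f sin0 expr0n /= mul0r !subr0.
  have := @ler_is_derive R f (fun s => cos s - (1 - s ^+ 2 / 2)) u u0.
  rewrite f0; apply.
    move=> s _; rewrite /f; apply: is_derive_eq.
    by rewrite /GRing.scale /=; field.
  by move=> s /andP[s0 _]; exact: c1.
have c2 (u : R) : 0 <= u -> 0 <= u ^+ 4 / 24 - (cos u - (1 - u ^+ 2 / 2)) :> R.
  move=> u0; pose f (s : R) := s ^+ 4 / 24 - (cos s - (1 - s ^+ 2 / 2)).
  have f0 : f 0 = 0 by rewrite /f cos0 !expr0n /= !mul0r subr0 subrr subr0.
  have := @ler_is_derive R f (fun s => s ^+ 3 / 6 - (s - sin s)) u u0.
  rewrite f0; apply.
    move=> s _; rewrite /f; apply: is_derive_eq.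
    by rewrite /GRing.scale /=; field.
  by move=> s /andP[s0 _]; exact: s2.
move=> t0; have := s2 t t0; have := c2 t t0.
by split; [exact: s1|lra|exact: c1|lra].
Qed.

Lemma cos_taylor2 (R : realType) (y : R) : `|y| <= 1 ->
  `|cos y - (1 - y ^+ 2 / 2)| <= `|y| ^+ 3.
Proof.
move=> y1; rewrite -cos_norm -[y ^+ 2](@real_normK R) ?num_real //.
have [_ _] := @cos_sin_taylor_pos R _ (normr_ge0 y).
set t := `|y| in y1 * => h1 h2; have t0 : 0 <= t by exact: normr_ge0.
have t3 : 0 <= t ^+ 3 by exact: exprn_ge0.
rewrite ger0_norm //; apply: (le_trans h2); rewrite exprSr; nra.
Qed.

Lemma sin_taylor2 (R : realType) (y : R) : `|sin y - y| <= `|y| ^+ 3.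
Proof.
wlog y0 : y / 0 <= y => [hw|].
  have [/hw//|y0] := leP 0 y; have : 0 <= - y by rewrite oppr_ge0 ltW.
  by move=> /hw; rewrite sinN -opprD !normrN.
have [h1 h2 _ _] := @cos_sin_taylor_pos R _ y0.
have t3 : 0 <= y ^+ 3 by exact: exprn_ge0.
by rewrite distrC (ger0_norm h1) (ger0_norm y0); lra.
Qed.

(** The two differences have derivatives [s ^+ 2 / (1 + s)] and [s ^+ 3 / (1 + s)], the remainders
    of the truncated geometric series of [1 / (1 + s)]. *)
Lemma ln1D_taylor2 (R : realType) (x : R) : 0 <= x ->
  x - x ^+ 2 / 2 <= ln (1 + x) <= x - x ^+ 2 / 2 + x ^+ 3 / 3.
Proof.
move=> x0; apply/andP; split; rewrite -subr_ge0.
- pose f (s : R) := ln (1 + s) - (s - s ^+ 2 / 2).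
  have f0 : f 0 = 0 by rewrite /f addr0 ln1 expr0n /= mul0r !subrr.
  have := @ler_is_derive R f (fun s => s ^+ 2 / (1 + s)) x x0.
  rewrite f0; apply => s /andP[s0 _].
    have h : 0 < 1 + s by lra.
    have hd := is_derive1_ln h; rewrite /f; apply: is_derive_eq.
    by rewrite /GRing.scale /=; field; lra.
  by rewrite divr_ge0 ?sqr_ge0 //; lra.
- pose f (s : R) := (s - s ^+ 2 / 2 + s ^+ 3 / 3) - ln (1 + s).
  have f0 : f 0 = 0 by rewrite /f addr0 ln1 !expr0n /= !mul0r subrr addr0 subrr.
  have := @ler_is_derive R f (fun s => s ^+ 3 / (1 + s)) x x0.
  rewrite f0; apply => s /andP[s0 _].
    have h : 0 < 1 + s by lra.
    have hd := is_derive1_ln h; rewrite /f; apply: is_derive_eq.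
    by rewrite /GRing.scale /=; field; lra.
  by rewrite divr_ge0 ?exprn_ge0 //; lra.
Qed.

(** * Limits of complex sequences *)

(** Convergence in the topology used by [clim]; unlike an equation on [clim u], it asserts that the
    limit exists. *)
Definition ccvg (R : realType) (u : nat -> R[i]) (l : R[i]) : Prop :=
  (u : nat -> (R[i])^o) @ \oo --> (l : (R[i])^o).


(** The norm of [R[i]] takes its values in [R[i]]; [cabs] is its real counterpart, on which [lra]
    and [nra] can work. *)
Lemma cabsE (R : realType) (z : R[i]) : `|z| = (cabs z)%:C.
Proof. by case: z => a b; rewrite normc_def. Qed.

Lemma cabs_ge0 (R : realType) (z : R[i]) : 0 <= cabs z.
Proof. by rewrite -lecR -cabsE normr_ge0. Qed.

Lemma cabsM (R : realType) (z w : R[i]) : cabs (z * w) = cabs z * cabs w.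
Proof. exact: ComplexField.Normc.normcM. Qed.

Lemma cabsX (R : realType) (z : R[i]) n : cabs (z ^+ n) = cabs z ^+ n.
Proof. by apply: complexI; rewrite -cabsE normrX cabsE -rmorphXn. Qed.

Lemma cabsD (R : realType) (z w : R[i]) : cabs (z + w) <= cabs z + cabs w.
Proof. exact: le_normcD. Qed.

Lemma cabsN (R : realType) (z : R[i]) : cabs (- z) = cabs z.
Proof. exact: normcN. Qed.

Lemma cabsr (R : realType) (x : R) : cabs x%:C = `|x|.
Proof. by rewrite /= expr0n addr0 sqrtr_sqr. Qed.

Lemma cabs_nat (R : realType) n : cabs (n%:R : R[i]) = n%:R.
Proof. by rewrite -[n%:R](rmorph_nat (real_complex R)) cabsr normr_nat. Qed.

Lemma cabs1 (R : realType) : cabs (1 : R[i]) = 1.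
Proof. exact: (cabs_nat R 1). Qed.

Lemma cabsV (R : realType) (z : R[i]) : cabs z^-1 = (cabs z)^-1.
Proof. exact: ComplexField.Normc.normcV. Qed.

Lemma Re_le_cabs (R : realType) (z : R[i]) : `|complex.Re z| <= cabs z.
Proof. by rewrite -lecR -cabsE normc_ge_Re. Qed.

Lemma Im_le_cabs (R : realType) (z : R[i]) : `|complex.Im z| <= cabs z.
Proof.
case: z => a b /=; rewrite -sqrtr_sqr ler_wsqrtr // lerDr; exact: sqr_ge0.
Qed.

Lemma cabs_le_ReIm (R : realType) (z : R[i]) :
  cabs z <= `|complex.Re z| + `|complex.Im z|.
Proof.
rewrite -lecR -cabsE [X in `|X|]complexE rmorphD /=.
apply: le_trans (ler_normD _ _) _.
by rewrite normrM !cabsE !cabsr [X in X%:C * _]/= expr0n add0r expr1n sqrtr1 mul1r.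
Qed.

Lemma ccvg_dist (R : realType) (u : nat -> R[i]) (l : R[i]) :
  (fun n => cabs (l - u n)) @ \oo --> (0 : R) -> ccvg u l.
Proof.
(* In the order of [R[i]], [0 < e] forces a zero imaginary part, so the radius is a real number. *)
move=> h; apply/cvgrPdist_lt => -[e e'] /=; rewrite ltcE /= => /andP[/eqP -> e0].
move/cvgrPdist_lt/(_ _ e0) : h; apply: filterS => n.
by rewrite sub0r normrN (ger0_norm (cabs_ge0 _)) cabsE ltcR.
Qed.

Lemma ccvg_ReIm (R : realType) (u : nat -> R[i]) (a b : R) :
  (fun n => complex.Re (u n)) @ \oo --> a ->
  (fun n => complex.Im (u n)) @ \oo --> b -> ccvg u (a +i* b).
Proof.
move=> hr hi; apply: ccvg_dist.
apply: (@squeeze_cvgr _ _ _ _ (cst 0)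
  (fun n => `|a - complex.Re (u n)| + `|b - complex.Im (u n)|)).
- apply: nearW => n; rewrite cabs_ge0 /=.
  by apply: le_trans (cabs_le_ReIm _) _; case: (u n).
- exact: cvg_cst.
- rewrite -[X in _ --> X]addr0; apply: cvgD; rewrite -[X in _ --> X](normr0 R);
    apply: cvg_norm.
    by rewrite -(subrr a); apply: cvgB => //; exact: cvg_cst.
  by rewrite -(subrr b); apply: cvgB => //; exact: cvg_cst.
Qed.

Lemma ccvg_real (R : realType) (x : nat -> R) (a : R) :
  x @ \oo --> a -> ccvg (fun n => (x n)%:C) a%:C.
Proof. by move=> h; apply: ccvg_ReIm => //=; exact: cvg_cst. Qed.

Lemma ccvg_cst (R : realType) (a : R[i]) : ccvg (fun=> a) a.
Proof. exact: cvg_cst. Qed.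

Lemma ccvgD (R : realType) (u v : nat -> R[i]) a b :
  ccvg u a -> ccvg v b -> ccvg (fun n => u n + v n) (a + b).
Proof. exact: cvgD. Qed.

Lemma ccvgM (R : realType) (u v : nat -> R[i]) a b :
  ccvg u a -> ccvg v b -> ccvg (fun n => u n * v n) (a * b).
Proof. exact: (@cvgM R[i]). Qed.

Lemma ccvgV (R : realType) (u : nat -> R[i]) a :
  a != 0 -> ccvg u a -> ccvg (fun n => (u n)^-1) a^-1.
Proof. by move=> a0; exact: (@cvgV R[i]). Qed.

Lemma ccvg_prod (R : realType) n (u : nat -> nat -> R[i]) (a : nat -> R[i]) :
  (forall i, (i < n)%N -> ccvg (u i) (a i)) ->
  ccvg (fun N => \prod_(0 <= i < n) u i N) (\prod_(0 <= i < n) a i).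
Proof.
elim: n => [|n IH] h.
  rewrite big_nil [X in ccvg X](_ : _ = fun=> 1); first exact: ccvg_cst.
  by apply/funext => N; rewrite big_nil.
rewrite big_nat_recr //= [X in ccvg X](_ : _ =
  fun N => (\prod_(0 <= i < n) u i N) * u n N); last first.
  by apply/funext => N; rewrite big_nat_recr.
by apply: ccvgM; [apply: IH => i iN; apply: h; rewrite ltnS ltnW|exact: h].
Qed.

Lemma ccvg_near (R : realType) (u v : nat -> R[i]) a :
  (\forall n \near \oo, u n = v n) -> ccvg u a -> ccvg v a.
Proof. by move=> h; apply: cvg_trans; apply: near_eq_cvg; apply: filterS h => n. Qed.

Lemma ccvg_clim (R : realType) (u : nat -> R[i]) a : ccvg u a -> clim u = a.
Proof. by move=> h; apply: (@cvg_lim ((R[i])^o)) h; exact: norm_hausdorff. Qed.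

Lemma ccvg_unique (R : realType) (u : nat -> R[i]) a b :
  ccvg u a -> ccvg u b -> a = b.
Proof. by move=> /ccvg_clim <- /ccvg_clim. Qed.

Lemma ccvg_comp (R : realType) (u : nat -> R[i]) (f : nat -> nat) a :
  (forall n, (n <= f n)%N) -> ccvg u a -> ccvg (u \o f) a.
Proof.
move=> nf; apply: cvg_comp => A [N _ NA]; exists N => // n /= Nn.
by apply: NA => /=; exact: leq_trans (nf n).
Qed.

(** * Euler's constant, Wallis's product and Stirling's formula *)

(* With [t N = 2 C / (N + 1)], the sequences [u - t] and [u + t] are adjacent. *)
Lemma cvg_summable_increments (R : realType) (u : nat -> R) (C : R) :
  (forall N, `|u N.+1 - u N| <= C / N.+1%:R ^+ 2) -> cvgn u.
Proof.
move=> hu; have C0 : 0 <= C by have := le_trans (normr_ge0 _) (hu 0%N); rewrite expr1n divr1.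
pose t N : R := 2 * C / N.+1%:R.
have st N : C / N.+1%:R ^+ 2 <= t N - t N.+1.
  rewrite /t -[N.+2%:R]natr1 -subr_ge0; set x : R := N.+1%:R.
  have x1 : 1 <= x by rewrite ler1n.
  rewrite (_ : _ - _ = C * (x - 1) / (x ^+ 2 * (x + 1))); last by field; lra.
  by rewrite divr_ge0 ?mulr_ge0 ?sqr_ge0 //; lra.
have t0 : t @ \oo --> (0 : R).
  rewrite -[X in _ --> X](mulr0 (2 * C)); apply: cvgM; first exact: cvg_cst.
  exact: cvg_harmonic.
have [|||_ h _] := @adjacent_seq R (fun N => u N - t N) (fun N => u N + t N).
- apply/nondecreasing_seqP => N /=; have := st N; have := hu N; move: (C / _) => D.
  by rewrite ler_norml => /andP[] /= *; lra.
- apply/nonincreasing_seqP => N /=; have := st N; have := hu N; move: (C / _) => D.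
  by rewrite ler_norml => /andP[] /= *; lra.
- rewrite (_ : _ - _ = fun N => t N + t N); last by apply/funext => N; rewrite !fctE; ring.
  by rewrite -[X in _ --> X](addr0 0); exact: cvgD.
- rewrite (_ : u = (fun N => u N - t N) \+ t); last by apply/funext => N /=; ring.
  by apply: is_cvgD => //; apply/cvg_ex; exists 0.
Qed.

Lemma cvg_summable_incrementsS (R : realType) (u : nat -> R) (C : R) :
  (forall N, (0 < N)%N -> `|u N.+1 - u N| <= C / N%:R ^+ 2) -> cvgn u.
Proof.
move=> hu; have /cvg_ex[l] : cvgn [sequence u N.+1]_N.
  by apply: (@cvg_summable_increments R _ C) => N /=; exact: hu.
by rewrite cvg_shiftS => ul; apply/cvg_ex; exists l.
Qed.

Lemma ln_natS (R : realType) N : (0 < N)%N ->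
  ln (N.+1%:R : R) = ln N%:R + ln (1 + N%:R^-1).
Proof.
move=> N0; have x0 : 0 < N%:R :> R by rewrite ltr0n.
rewrite -lnM ?posrE ?addr_gt0 ?invr_gt0 //; congr ln.
by rewrite -natr1; field; lra.
Qed.

Lemma ln1V_taylor (R : realType) N : (0 < N)%N -> let x : R := N%:R^-1 in
  [/\ 0 < x, x <= 1 & x - x ^+ 2 / 2 <= ln (1 + x) <= x - x ^+ 2 / 2 + x ^+ 3 / 3].
Proof.
move=> N0 /=; have x0 : 0 < N%:R :> R by rewrite ltr0n.
split; [by rewrite invr_gt0|by rewrite invf_le1 ?ler1n|].
by apply: ln1D_taylor2; rewrite invr_ge0 ltW.
Qed.

(** With [x = 1 / N] the increment is [x / (1 + x) - ln (1 + x)]; both terms are [x + O(x ^ 2)]. *)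
Lemma cvg_euler_gamma (R : realType) :
  (fun N => \sum_(1 <= k < N.+1) k%:R^-1 - ln N%:R) @ \oo --> (euler_gamma : R).
Proof.
(* [euler_gamma] is the [lim] of this very sequence, so mere convergence identifies the limit. *)
suff h : cvgn (fun N => \sum_(1 <= k < N.+1) k%:R^-1 - ln (N%:R : R)) by exact: h.
apply: (@cvg_summable_incrementsS R _ 1) => N N0.
rewrite big_nat_recr //= ln_natS // -(@natr1 _ N).
have [x0 x1 /andP[]] := @ln1V_taylor R N N0; set x := N%:R^-1 in x0 x1 *.
have -> : N%:R = x^-1 by rewrite /x invrK.
have -> : (x^-1 + 1)^-1 = x - x ^+ 2 / (1 + x) by field; lra.
rewrite mul1r -exprVn invrK; set S := \sum_(_ <= _ < _) _; set y := _ / (1 + x).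
have x2 : 0 <= x ^+ 2 by exact: sqr_ge0.
have y0 : 0 <= y by rewrite divr_ge0 //; lra.
have y1 : y <= x ^+ 2 by rewrite ler_pdivrMr; nra.
have x3 : x ^+ 3 <= x ^+ 2 by rewrite exprSr; nra.
by move=> h1 h2; rewrite ler_norml; apply/andP; split; lra.
Qed.

(* The logarithm of [N! / (N ^ (N + 1/2) exp (- N))]. *)
Definition stirling (R : realType) N : R :=
  ln N`!%:R - (N%:R + 2^-1) * ln N%:R + N%:R.

(** The increment is [1 - (N + 1/2) ln (1 + 1/N)]; the summand 1/2 cancels the term of order [1/N]
    and leaves [O(1 / N ^ 2)]. *)
Lemma is_cvg_stirling (R : realType) : cvgn (@stirling R).
Proof.
apply: (@cvg_summable_incrementsS R _ 1) => N N0.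
rewrite /stirling factS natrM lnM ?posrE ?ltr0n ?fact_gt0 // ln_natS // -(@natr1 _ N).
have [x0 x1 /andP[]] := @ln1V_taylor R N N0; set x := N%:R^-1 in x0 x1 *.
set L := ln (1 + x) => h1 h2.
have -> : N%:R = x^-1 by rewrite /x invrK.
rewrite mul1r -exprVn invrK.
rewrite (_ : _ - _ = 1 - (x^-1 + 2^-1) * L); last by field; lra.
have k1 : x^-1 * L <= 1 - x / 2 + x ^+ 2 / 3.
  rewrite mulrC ler_pdivrMr //; apply: (le_trans h2).
  by rewrite le_eqVlt; apply/orP; left; apply/eqP; field.
have k2 : 1 - x / 2 <= x^-1 * L.
  rewrite [_^-1 * _]mulrC ler_pdivlMr //; apply: le_trans h1.
  by rewrite le_eqVlt; apply/orP; left; apply/eqP; field.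
have x3 : x ^+ 3 <= x ^+ 2 by rewrite exprSr; nra.
by rewrite mulrDl ler_norml; apply/andP; split; lra.
Qed.

(* [cos_prim k] is the antiderivative of [cos ^+ k] vanishing at [0], given by
   the usual reduction formula. *)
Fixpoint cos_prim (R : realType) k (x : R) : R :=
  match k with
  | 0 => x
  | 1 => sin x
  | k'.+2 => (sin x * cos x ^+ k'.+1 + k'.+1%:R * cos_prim k' x) / k'.+2%:R
  end.

Lemma is_derive_cos_prim (R : realType) k (x : R) :
  is_derive x 1 (cos_prim k) (cos x ^+ k).
Proof.
have [n] := ubnP k; elim: n k => // n IH [|[|k]] kn.
- rewrite expr0; exact: is_derive_id.
- rewrite expr1; exact: is_derive_sin.
have := IH k (ltnW kn) => h.
rewrite [cos_prim _](_ : _ =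
    k.+2%:R^-1 *: (sin * cos ^+ k.+1 + k.+1%:R *: cos_prim k)); last first.
  by apply/funext => y; rewrite !fctE /GRing.scale /= mulrC.
have hs := is_derive_sin x; have hX := is_deriveX k.+1 (is_derive_cos x).
apply: is_derive_eq (is_deriveZ _ (is_deriveD (is_deriveM hs hX) (is_deriveZ _ h))) _.
rewrite /GRing.scale /= !fctE !exprS.
have := cos2Dsin2 x; set c := cos x; set s := sin x => cs.
have -> : s * (k.+1%:R * c ^+ k * - s) = - (k.+1%:R * c ^+ k * s ^+ 2) by ring.
have -> : s ^+ 2 = 1 - c ^+ 2 by rewrite -cs; ring.
have p := ler0n R k; rewrite -!natr1; field; rewrite gt_eqF //; lra.
Qed.

Lemma cos_prim0 (R : realType) k : cos_prim k 0 = 0 :> R.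
Proof.
have [n] := ubnP k; elim: n k => // n IH [|[|k]] kn //=; first exact: sin0.
by rewrite sin0 mul0r (IH k (ltnW kn)) mulr0 addr0 mul0r.
Qed.

(** [cos_prim k (pi / 2)] is Wallis's integral of [cos ^+ k] over [[0, pi / 2]]; the boundary term
    of the reduction formula vanishes there with the cosine. *)
Lemma wallis_rec (R : realType) k :
  cos_prim k.+2 (pi / 2) = k.+1%:R / k.+2%:R * cos_prim k (pi / 2) :> R.
Proof. by rewrite /= cos_pihalf exprS mul0r mulr0 add0r mulrAC. Qed.

Lemma wallis_decr (R : realType) k :
  cos_prim k.+1 (pi / 2) <= cos_prim k (pi / 2) :> R.
Proof.
rewrite -subr_ge0; have pi0 : 0 <= pi / 2 :> R by rewrite divr_ge0 ?pi_ge0.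
pose f (s : R) := cos_prim k s - cos_prim k.+1 s.
have f0 : f 0 = 0 by rewrite /f !cos_prim0 subrr.
have := @ler_is_derive R f (fun s => cos s ^+ k - cos s ^+ k.+1) _ pi0.
rewrite f0; apply.
  move=> s _; rewrite /f; apply: is_deriveB; exact: is_derive_cos_prim.
move=> s /andP[s0 s1]; rewrite exprS -{1}[_ ^+ k]mul1r -mulrBl.
have c0 : 0 <= cos s by apply: cos_ge0_pihalf; rewrite s1 andbT; lra.
by rewrite mulr_ge0 ?exprn_ge0 // subr_ge0 cos_le1.
Qed.

(** This is [(2N)!! / (2N - 1)!!], the product of [2k / (2k - 1)] for k from 1 to N. *)
Definition wallis (R : realType) N : R := 4 ^+ N * N`!%:R ^+ 2 / (2 * N)`!%:R.

Lemma wallis_gt0 (R : realType) N : 0 < wallis R N.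
Proof.
by rewrite /wallis divr_gt0 ?mulr_gt0 ?exprn_gt0 ?ltr0n ?fact_gt0.
Qed.

Lemma wallisS (R : realType) N :
  wallis R N.+1 = wallis R N * (N.+1.*2%:R / N.*2.+1%:R).
Proof.
rewrite /wallis -!mul2n mulnS !factS !natrM exprS.
have h1 : (2 * N)`!%:R != 0 :> R by rewrite pnatr_eq0 -lt0n fact_gt0.
have p := ler0n R N.
by field; rewrite h1 !gt_eqF //; lra.
Qed.

Lemma cos_prim_even (R : realType) N :
  cos_prim N.*2 (pi / 2) = pi / 2 / wallis R N.
Proof.
elim: N => [|N IH]; first by rewrite /wallis expr0 mul1r expr1n !divr1.
have h : wallis R N != 0 by rewrite gt_eqF // wallis_gt0.
rewrite doubleS wallis_rec IH wallisS doubleS.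
have p := ler0n R N.*2.
by field; rewrite h !gt_eqF //; lra.
Qed.

Lemma cos_prim_odd (R : realType) N :
  cos_prim N.*2.+1 (pi / 2) = wallis R N / N.*2.+1%:R.
Proof.
elim: N => [|N IH]; first by rewrite /wallis /= sin_pihalf expr0 mul1r expr1n !divr1.
rewrite doubleS wallis_rec IH wallisS doubleS.
have p := ler0n R N.*2.
by field; rewrite !gt_eqF //; lra.
Qed.

(** Wallis's integrals decrease with the exponent: comparing those of exponents [2N] and [2N - 1]
    gives the lower bound, those of exponents [2N + 1] and [2N] the upper one. *)
Lemma wallis_bounds (R : realType) N : (0 < N)%N ->
  pi <= wallis R N ^+ 2 / N%:R <= pi + pi / 2 * N%:R^-1.
Proof.
move=> N0; have W0 := wallis_gt0 R N; set W := wallis R N in W0 *.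
have x0 : 0 < N%:R :> R by rewrite ltr0n.
have NE : N.*2%:R = 2 * N%:R :> R by rewrite -muln2 natrM mulrC.
have pi0 := pi_gt0 R.
apply/andP; split.
- have e : wallis R N.-1 / N.-1.*2.+1%:R = W / (2 * N%:R).
    rewrite /W -[in RHS](prednK N0) wallisS doubleS prednK // -doubleS prednK // NE.
    have p := ler0n R N.-1.*2; field; rewrite !gt_eqF //; lra.
  have := wallis_decr R N.-1.*2.+1; rewrite -doubleS prednK //.
  rewrite cos_prim_even cos_prim_odd -/W e ler_pdivrMr // => h.
  rewrite ler_pdivlMr //; have -> : pi * N%:R = pi / 2 * (2 * N%:R) :> R by field.
  rewrite -ler_pdivlMr ?mulr_gt0 //; apply: (le_trans h).
  by rewrite le_eqVlt; apply/orP; left; apply/eqP; field; rewrite gt_eqF.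
- have := wallis_decr R N.*2; rewrite cos_prim_even cos_prim_odd -/W.
  rewrite ler_pdivrMr ?ltr0n // -[N.*2.+1%:R]natr1 NE => h.
  have {}h : W ^+ 2 <= pi / 2 * (2 * N%:R + 1).
    rewrite expr2 -ler_pdivlMl // mulrC; apply: (le_trans h).
    by rewrite le_eqVlt; apply/orP; left; apply/eqP; field; rewrite gt_eqF.
  rewrite ler_pdivrMr //; apply: (le_trans h).
  by rewrite le_eqVlt; apply/orP; left; apply/eqP; field; rewrite gt_eqF.
Qed.

Lemma cvg_wallis (R : realType) :
  (fun N => wallis R N ^+ 2 / N%:R) @ \oo --> (pi : R).
Proof.
apply: (@squeeze_cvgr _ _ _ _ (cst pi) (fun N => pi + pi / 2 * N%:R^-1)).
- by exists 1%N => // N /= N0; exact: wallis_bounds.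
- exact: cvg_cst.
- rewrite -[X in _ --> X]addr0; apply: cvgD; first exact: cvg_cst.
  rewrite -[X in _ --> X](mulr0 (pi / 2)); apply: cvgM; first exact: cvg_cst.
  by rewrite -cvg_shiftS; exact: cvg_harmonic.
Qed.

(* The limit l satisfies [l = 2 l - l], and
   [2 stirling N - stirling (2 N) = ln (2 wallis N ^ 2 / N) / 2]. *)
Lemma cvg_stirling (R : realType) :
  stirling R @ \oo --> (ln (2 * pi) / 2 : R).
Proof.
have /cvg_ex[l hl] := @is_cvg_stirling R.
suff <- : l = ln (2 * pi) / 2 by [].
have h2 : (fun N => 2 * stirling R N - stirling R (2 * N)) @ \oo --> (2 * l - l : R).
  apply: cvgB; first by apply: cvgM => //; exact: cvg_cst.
  apply: (cvg_comp _ _ _ hl) => A [N _ NA]; exists N => // n /= Nn.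
  by apply: NA => /=; rewrite mul2n -addnn; exact: leq_trans (leq_addr _ _).
have pi0 := pi_gt0 R.
have h3 : (fun N => ln (2 * (wallis R N ^+ 2 / N%:R)) / 2) @ \oo --> (ln (2 * pi) / 2 : R).
  apply: cvgM; last exact: cvg_cst.
  apply: (@continuous_cvg _ _ _ _ _ (fun N => 2 * (wallis R N ^+ 2 / N%:R)) (@ln R)).
    by apply: continuous_ln; rewrite mulr_gt0.
  by apply: cvgM; [exact: cvg_cst|exact: cvg_wallis].
apply/esym; apply: (cvg_unique (@norm_hausdorff _ R) h3).
rewrite (_ : l = 2 * l - l); last by ring.
apply: cvg_trans h2; apply: near_eq_cvg; exists 1%N => // N /= N0.
have x0 : 0 < N%:R :> R by rewrite ltr0n.
have f0 n : 0 < n`!%:R :> R by rewrite ltr0n fact_gt0.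
have -> : ln (2 * (wallis R N ^+ 2 / N%:R)) =
    ln 2 + (ln 4 *+ N + ln N`!%:R *+ 2 - ln (2 * N)`!%:R) *+ 2 - ln (N%:R : R).
  have W0 := wallis_gt0 R N.
  rewrite lnM ?posrE ?divr_gt0 ?exprn_gt0 // ln_div ?posrE ?exprn_gt0 // lnXn //.
  rewrite /wallis ln_div ?posrE ?mulr_gt0 ?exprn_gt0 // lnM ?posrE ?exprn_gt0 //.
  by rewrite !lnXn // addrA.
have -> : ln 4 = ln 2 *+ 2 :> R by rewrite -lnXn //; congr ln; ring.
rewrite /stirling natrM lnM ?posrE //.
by field.
Qed.

(** * The complex exponential and infinite products *)

Lemma cexpD (R : realType) (z w : R[i]) : cexp (z + w) = cexp z * cexp w.
Proof.
case: z w => [a b] [c d]; rewrite /cexp /= expRD cosD sinD.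
by apply/eqP; rewrite eq_complex /=; apply/andP; split; apply/eqP; ring.
Qed.

Lemma cexp_real (R : realType) (x : R) : cexp x%:C = (expR x)%:C.
Proof. by rewrite /cexp /= cos0 sin0 complexr0 mulr1. Qed.

Lemma cexp0 (R : realType) : cexp (0 : R[i]) = 1.
Proof. by rewrite -[0]/((0 : R)%:C) cexp_real expR0. Qed.

Lemma cexpN (R : realType) (z : R[i]) : cexp z * cexp (- z) = 1.
Proof. by rewrite -cexpD subrr cexp0. Qed.

Lemma cexp_neq0 (R : realType) (z : R[i]) : cexp z != 0.
Proof. by apply/eqP => h; have /eqP := cexpN z; rewrite h mul0r eq_sym oner_eq0. Qed.

Lemma cexpV (R : realType) (z : R[i]) : (cexp z)^-1 = cexp (- z).
Proof. by apply: (mulfI (cexp_neq0 z)); rewrite divff ?cexp_neq0 // cexpN. Qed.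

Lemma cexp_mulnr (R : realType) n (z : R[i]) : cexp (z * n%:R) = cexp z ^+ n.
Proof.
elim: n => [|n IH]; first by rewrite mulr0 cexp0.
by rewrite -natr1 mulrDr mulr1 cexpD IH exprSr.
Qed.

Lemma cexp_sum (R : realType) (I : Type) (r : seq I) (P : pred I) (f : I -> R[i]) :
  cexp (\sum_(i <- r | P i) f i) = \prod_(i <- r | P i) cexp (f i).
Proof. by apply: (big_morph (@cexp R)); [exact: cexpD|exact: cexp0]. Qed.

Lemma cexp_ln (R : realType) (x : R) : 0 < x -> cexp (ln x)%:C = x%:C.
Proof. by move=> x0; rewrite cexp_real lnK. Qed.

(** Exponents that vary with N will always be a real sequence times a fixed complex number, so
    continuity along real multiples of [z] suffices. *)
Lemma ccvg_cexp_real (R : realType) (z : R[i]) (x : nat -> R) (a : R) :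
  x @ \oo --> a -> ccvg (fun n => cexp (z * (x n)%:C)) (cexp (z * a%:C)).
Proof.
move=> h; case: z => c d.
have e t : cexp ((c +i* d) * t%:C) = (expR (c * t))%:C * (cos (d * t) +i* sin (d * t)).
  by rewrite /cexp /= !mulr0 subr0 add0r.
rewrite e [X in ccvg X _](_ : _ =
  fun n => (expR (c * x n))%:C * (cos (d * x n) +i* sin (d * x n))); last exact/funext.
have hc k : (fun n => k * x n) @ \oo --> k * a by apply: cvgM => //; exact: cvg_cst.
apply: ccvgM.
  apply: ccvg_real; apply: (@continuous_cvg _ _ _ _ _ (fun n => c * x n) (@expR R)) => //.
  exact: continuous_expR.
apply: ccvg_ReIm => /=.
  apply: (@continuous_cvg _ _ _ _ _ (fun n => d * x n) (@cos R)) => //.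
  exact: continuous_cos.
apply: (@continuous_cvg _ _ _ _ _ (fun n => d * x n) (@sin R)) => //.
exact: continuous_sin.
Qed.

Lemma cexp_taylor2 (R : realType) (z : R[i]) : cabs z <= 1 ->
  cabs (cexp z - (1 + z + z ^+ 2 / 2)) <= 12 * cabs z ^+ 3.
Proof.
move=> z1; apply: le_trans (cabs_le_ReIm _) _.
have := Re_le_cabs z; have := Im_le_cabs z; have := cabs_ge0 z.
have -> : z ^+ 2 / 2 = ((complex.Re z ^+ 2 - complex.Im z ^+ 2) / 2)
    +i* (complex.Re z * complex.Im z) :> R[i].
  have e2 : 2^-1 = (2^-1 : R)%:C :> R[i] by rewrite fmorphV /= rmorph_nat.
  rewrite e2 expr2; case: (z) => a b; apply/eqP; rewrite eq_complex /=.
  by apply/andP; split; apply/eqP; field.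
move=> r0 hy hx.
have x1 := le_trans hx z1; have y1 := le_trans hy z1.
have := expR_taylor2 x1; have := cos_taylor2 y1; have := @sin_taylor2 R (complex.Im z).
case: z z1 r0 hx hy x1 y1 => x y; set r := cabs _; clearbody r => r1 r0 /= hx hy x1 y1.
set e := expR x - _; set a := cos y - _; set b := sin y - _.
have r3 : 0 <= r ^+ 3 by exact: exprn_ge0.
have hx3 : `|x| ^+ 3 <= r ^+ 3 by rewrite lerXn2r ?nnegrE.
have hy3 : `|y| ^+ 3 <= r ^+ 3 by rewrite lerXn2r ?nnegrE.
move=> /le_trans/(_ hy3) hb /le_trans/(_ hy3) ha /le_trans/(_ hx3) he.
have bM (u v U V : R) : `|u| <= U -> `|v| <= V -> `|u * v| <= U * V.
  by move=> hu hv; rewrite normrM ler_pM.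
have r31 : r ^+ 3 <= 1 by rewrite exprn_ile1.
have r2 : `|x ^+ 2| <= r * r by exact: bM.
have s2 : `|y ^+ 2| <= r * r by exact: bM.
have rr : r * r * (r * r) <= r ^+ 3.
  by rewrite (_ : _ * _ = r ^+ 3 * r) ?ler_piMr //; ring.
have hE : `|1 + x + x ^+ 2 / 2| <= 3.
  by move: x1 r2; rewrite !ler_norml => /andP[? ?] /andP[? ?]; apply/andP; split; nra.
(* The four terms of the decomposition are at most [1], [3], [1/2] and [1/4] times [r ^+ 3]. The
   imaginary part is treated likewise, and the final 12 is [6 + 6]. *)
have hre : `|expR x * cos y - 0 * sin y - (1 + x + (x ^+ 2 - y ^+ 2) / 2)| <= 6 * r ^+ 3.
  rewrite (_ : _ - _ = e * cos y + (1 + x + x ^+ 2 / 2) * a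
    - (2^-1 * (x * y ^+ 2) + 4^-1 * (x * y) ^+ 2)); last by rewrite /e /a; field.
  have := bM _ _ _ _ he (cos_max y); have := bM _ _ _ _ hE ha.
  have := bM _ _ _ _ hx s2; have := bM _ _ _ _ r2 s2.
  have -> : r * (r * r) = r ^+ 3 by ring.
  have -> : x ^+ 2 * y ^+ 2 = (x * y) ^+ 2 by ring.
  move: (e * _) (_ * a) (x * y ^+ 2) ((x * y) ^+ 2) => e1 e2 e3 e4.
  rewrite !ler_norml => /andP[? ?] /andP[? ?] /andP[? ?] /andP[? ?].
  by apply/andP; split; lra.
have him : `|expR x * sin y + 0 * cos y - (0 + y + x * y)| <= 6 * r ^+ 3.
  rewrite (_ : _ - _ = e * sin y + (1 + x + x ^+ 2 / 2) * b + 2^-1 * (x ^+ 2 * y)); last first.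
    by rewrite /e /b; field.
  have := bM _ _ _ _ he (sin_max y); have := bM _ _ _ _ hE hb.
  have := bM _ _ _ _ r2 hy; rewrite (_ : r * r * r = r ^+ 3); last by ring.
  move: (e * _) (_ * b) (x ^+ 2 * y) => e1 e2 e3.
  rewrite !ler_norml => /andP[? ?] /andP[? ?] /andP[? ?].
  by apply/andP; split; lra.
have := lerD hre him; rewrite (_ : 6 * _ + _ = 12 * r ^+ 3) //; ring.
Qed.

(** * Infinite products of factors close to 1 *)

(** Bounded partial products have increments [P N * (v N.+1 - 1)] of order [1 / N ^ 2], so their
    real and imaginary parts converge. *)
Lemma ccvg_prod_ex (R : realType) (v : nat -> R[i]) (C : R) :
  (forall k, (0 < k)%N -> cabs (v k - 1) <= C / k%:R ^+ 2) ->
  exists l, ccvg (fun N => \prod_(1 <= k < N.+1) v k) l.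
Proof.
move=> hv; have C0 : 0 <= C by have := le_trans (cabs_ge0 _) (hv 1%N isT); rewrite expr1n divr1.
pose P N := \prod_(1 <= k < N.+1) v k.
have PS N : P N.+1 = P N * v N.+1 by rewrite /P big_nat_recr.
(* A telescoping majorant of [exp (\sum C / k ^ 2)], from [C / k ^ 2 <= 2 C / k - 2 C / (k + 1)]. *)
have hP N : cabs (P N) <= expR (2 * C - 2 * C / N.+1%:R).
  elim: N => [|N IH]; first by rewrite /P big_nil cabs1 divr1 subrr expR0.
  rewrite PS cabsM.
  have h : cabs (v N.+1) <= expR (C / N.+1%:R ^+ 2).
    rewrite -[v _](subrK 1); apply: (le_trans (cabsD _ _)); rewrite cabs1 addrC.
    by apply: le_trans (expR_ge1Dx _); rewrite lerD2l hv.
  apply: (le_trans (ler_pM (cabs_ge0 _) (cabs_ge0 _) IH h)).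
  rewrite -expRD ler_expR -[N.+2%:R]natr1; set x : R := N.+1%:R.
  have x1 : 1 <= x by rewrite ler1n.
  rewrite -subr_ge0 (_ : _ - _ = C * (x - 1) / (x ^+ 2 * (x + 1))).
    by rewrite divr_ge0 ?mulr_ge0 ?sqr_ge0 //; lra.
  by field; rewrite !gt_eqF //; lra.
have hP' N : cabs (P N.+1 - P N) <= expR (2 * C) * C / N.+1%:R ^+ 2.
  rewrite PS -[X in _ - X]mulr1 -mulrBr cabsM -mulrA ler_pM ?cabs_ge0 ?hv //.
  apply: (le_trans (hP N)); rewrite ler_expR lerBlDr lerDl.
  by rewrite divr_ge0 ?mulr_ge0 ?ler0n.
have /cvg_ex[a ha] : cvgn (fun N => complex.Re (P N)).
  apply: (@cvg_summable_increments R _ (expR (2 * C) * C)) => N.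
  by rewrite -raddfB; exact: le_trans (Re_le_cabs _) (hP' N).
have /cvg_ex[b hb] : cvgn (fun N => complex.Im (P N)).
  apply: (@cvg_summable_increments R _ (expR (2 * C) * C)) => N.
  by rewrite -raddfB; exact: le_trans (Im_le_cabs _) (hP' N).
by exists (a +i* b); exact: ccvg_ReIm.
Qed.

(** The factors below [K] are absorbed into the constant: [D] sums [k ^ 2 * cabs (v k - 1)] over
    them and so dominates each of these numbers. *)
Lemma ccvg_prod_ex_near (R : realType) (v : nat -> R[i]) (C : R) K :
  (forall k, (K <= k)%N -> cabs (v k - 1) <= C / k%:R ^+ 2) ->
  exists l, ccvg (fun N => \prod_(1 <= k < N.+1) v k) l.
Proof.
move=> hv; pose D : R := \sum_(0 <= k < K) k%:R ^+ 2 * cabs (v k - 1).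
have t0 k : 0 <= k%:R ^+ 2 * cabs (v k - 1) by rewrite mulr_ge0 ?sqr_ge0 ?cabs_ge0.
have D0 : 0 <= D by exact: sumr_ge0.
apply: (@ccvg_prod_ex _ _ (`|C| + D)) => k k0.
have k2 : 0 < k%:R ^+ 2 :> R by rewrite exprn_gt0 ?ltr0n.
rewrite ler_pdivlMr // mulrC; have [Kk|kK] := leqP K k.
  have := hv k Kk; rewrite ler_pdivlMr // mulrC => /le_trans; apply.
  by have := ler_norm C; lra.
rewrite /D (bigD1_seq k) /= ?mem_index_iota ?iota_uniq //=.
have := normr_ge0 C; have : 0 <= \sum_(0 <= i < K | i != k) i%:R ^+ 2 * cabs (v i - 1).
  exact: sumr_ge0.
lra.
Qed.

(* The limit is nonzero because the product of the inverses converges too. *)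
Lemma ccvg_prod_neq0 (R : realType) (v : nat -> R[i]) (C : R) K :
  (forall k, (K <= k)%N -> cabs (v k - 1) <= C / k%:R ^+ 2) ->
  (forall k, (0 < k)%N -> v k != 0) ->
  exists2 l, l != 0 & ccvg (fun N => \prod_(1 <= k < N.+1) v k) l.
Proof.
move=> hv v0; have [l hl] := ccvg_prod_ex_near hv.
(* From [K'] on, [2 C <= k <= k ^ 2]; hence [v k] is within 1/2 of 1, has modulus at least 1/2, and
   inversion at most doubles its distance to 1. *)
pose K' := maxn (maxn K 1) (Num.bound `|2 * C|).
have [l' hl'] : exists l, ccvg (fun N => \prod_(1 <= k < N.+1) (v k)^-1) l.
  apply: (@ccvg_prod_ex_near _ _ (2 * C) K') => k.
  rewrite !geq_max => /andP[/andP[Kk k1] kC].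
  have kR : 1 <= k%:R :> R by rewrite ler1n.
  have kC' : 2 * C <= k%:R ^+ 2.
    have h := archi_boundP (normr_ge0 (2 * C)); have hC := ler_norm (2 * C).
    have : (Num.bound `|2 * C|)%:R <= k%:R :> R by rewrite ler_nat.
    nra.
  have h := hv k Kk.
  have h2 : 2^-1 <= cabs (v k).
    have : cabs 1 <= cabs (v k) + cabs (- (v k - 1)).
      by apply: le_trans (cabsD _ _); rewrite opprB addrC subrK.
    rewrite cabs1 cabsN; have : C / k%:R ^+ 2 <= 2^-1 by rewrite ler_pdivrMr ?exprn_gt0 //; lra.
    lra.
  have -> : (v k)^-1 - 1 = - (v k - 1) / v k by field; exact: v0.
  rewrite cabsM cabsN cabsV ler_pdivrMr; last by lra.
  apply: (le_trans h); rewrite -mulrA.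
  have := le_trans (cabs_ge0 _) h; move: (C / _) => q q0; nra.
exists l => //; apply/eqP => l0; have := ccvgM hl hl'; rewrite l0 mul0r.
rewrite [X in ccvg X](_ : _ = fun=> 1); last first.
  apply/funext => N; rewrite -big_split /= big_nat big1 // => k /andP[k0 _].
  by rewrite divff ?v0.
by move=> /(ccvg_unique (@ccvg_cst R 1))/eqP; rewrite oner_eq0.
Qed.

(** Carries an estimate from a base to its power. With [d] the distance from [x] to 1, induction
    bounds the left side by [expR (n d) - 1], and [expR t - 1 <= t * expR t] is the tangent
    inequality at [- t]. *)
Lemma cabs_exprB1 (R : realType) (x : R[i]) n (t : R) :
  n%:R * cabs (x - 1) <= t -> cabs (x ^+ n - 1) <= t * expR t.
Proof.
set d := cabs (x - 1) => h; have d0 : 0 <= d by exact: cabs_ge0.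
have {h} ht : expR (n%:R * d) - 1 <= t * expR t.
  have t0 : 0 <= n%:R * d by rewrite mulr_ge0.
  have h1 : 1 - t <= expR (- t) by exact: expR_ge1Dx.
  have h2 : expR (- t) * expR t = 1 by rewrite -expRD addNr expR0.
  have h3 : expR (n%:R * d) <= expR t by rewrite ler_expR.
  have := expR_gt0 t; nra.
apply: le_trans ht; elim: n => [|n IH]; first by
  rewrite expr0 subrr mul0r expR0 subrr ComplexField.Normc.normc0.
have -> : x ^+ n.+1 - 1 = (x ^+ n - 1) * x + (x - 1) by rewrite exprSr; ring.
apply: (le_trans (cabsD _ _)); rewrite cabsM -/d.
have hx : cabs x <= 1 + d by rewrite -[x](subrK 1) addrC -(cabs1 R); exact: cabsD.
have := ler_pM (cabs_ge0 _) (cabs_ge0 _) IH hx.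
have -> : n.+1%:R * d = n%:R * d + d by rewrite -natr1; ring.
rewrite expRD; have := @expR_ge1Dx R d.
have := expR_gt0 (n%:R * d); set E := expR (n%:R * d); set F := expR d.
move: (cabs _ * _) => q; nra.
Qed.

(** The linear terms cancel. The constant is [1 + 2 * 12], with 12 from the remainder of [cexp] and
    2 bounding [1 + z]. *)
Lemma cabs_prod1 (R : realType) (z : R[i]) : cabs z <= 1 ->
  cabs ((1 + z) * cexp (- z) - 1) <= 25 * cabs z ^+ 2.
Proof.
move=> z1; have z0 := cabs_ge0 z.
have := @cexp_taylor2 R (- z); rewrite cabsN => /(_ z1).
set rho := cexp (- z) - _ => hrho.
have -> : (1 + z) * cexp (- z) - 1 = z ^+ 2 * ((z - 1) / 2) + (1 + z) * rho.
  by rewrite /rho; field.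
have h2 : cabs ((z - 1) / 2) <= 1.
  rewrite cabsM cabsV cabs_nat ler_pdivrMr //; apply: (le_trans (cabsD _ _)).
  by rewrite cabsN cabs1; lra.
have h3 : cabs (1 + z) <= 2 by apply: (le_trans (cabsD _ _)); rewrite cabs1; lra.
apply: (le_trans (cabsD _ _)); rewrite cabsM (cabsM (1 + z)).
have := ler_pM (cabs_ge0 _) (cabs_ge0 _) (lexx (cabs (z ^+ 2))) h2.
have := ler_pM (cabs_ge0 _) (cabs_ge0 _) h3 hrho.
rewrite cabsX; have : cabs z ^+ 3 <= cabs z ^+ 2 by rewrite exprSr; have := sqr_ge0 (cabs z); nra.
lra.
Qed.

(** The exponent is the opposite of the logarithm of [1 + z] to second order, so the quadratic terms
    cancel as well. At [z = w / k] this is the base of the k-th factor of G. The constant 200 rounds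
    up [2 + 2 * 12 * 2 ^ 3]. *)
Lemma cabs_prod2 (R : realType) (z : R[i]) : cabs z <= 2^-1 ->
  cabs ((1 + z) * cexp (z ^+ 2 / 2 - z) - 1) <= 200 * cabs z ^+ 3.
Proof.
move=> z1; have z0 := cabs_ge0 z; set h := z ^+ 2 / 2 - z.
have hh : cabs h <= 2 * cabs z.
  apply: (le_trans (cabsD _ _)); rewrite cabsN cabsM cabsV cabs_nat cabsX; nra.
have h1 : cabs h <= 1 by lra.
have := cexp_taylor2 h1; set rho := cexp h - _ => hrho.
have -> : (1 + z) * cexp h - 1 =
    z ^+ 3 * (2^-1 + z * (- 3 / 8) + z ^+ 2 / 8) + (1 + z) * rho.
  by rewrite /rho /h; field.
have h3 : cabs (1 + z) <= 2 by apply: (le_trans (cabsD _ _)); rewrite cabs1; lra.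
have hc : cabs (2^-1 + z * (- 3 / 8) + z ^+ 2 / 8) <= 2.
  apply: (le_trans (cabsD _ _)); apply: le_trans (lerD (cabsD _ _) (lexx _)) _.
  rewrite (cabsM z) (cabsM (-3)) (cabsM (z ^+ 2)) cabsX cabsN !cabsV !cabs_nat.
  nra.
have hrho' : cabs rho <= 96 * cabs z ^+ 3.
  apply: (le_trans hrho); have : cabs h ^+ 3 <= (2 * cabs z) ^+ 3.
    by rewrite lerXn2r ?nnegrE ?mulr_ge0 ?cabs_ge0.
  by rewrite exprMn; lra.
apply: (le_trans (cabsD _ _)); rewrite cabsM (cabsM (1 + z)).
have := ler_pM (cabs_ge0 _) (cabs_ge0 _) (lexx (cabs (z ^+ 3))) hc.
have := ler_pM (cabs_ge0 _) (cabs_ge0 _) h3 hrho'.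
rewrite cabsX; have := exprn_ge0 3 z0.
lra.
Qed.

Lemma cvg_divn0 (R : realType) (c : R) : (fun N => c / N%:R) @ \oo --> (0 : R).
Proof.
rewrite -[X in _ --> X](mulr0 c); apply: cvgM; first exact: cvg_cst.
by rewrite -cvg_shiftS; exact: cvg_harmonic.
Qed.

Lemma near_divn_le (R : realType) (c e : R) : 0 < e ->
  exists K, forall k, (K <= k)%N -> (0 < k)%N /\ c / k%:R <= e.
Proof.
move=> e0; have /cvgrPdist_lt/(_ _ e0)[K _ hK] := cvg_divn0 c.
exists K.+1 => k Kk; split; first exact: leq_trans Kk.
have := hK k (ltnW Kk); rewrite /= sub0r normrN => /ltW; apply: le_trans.
exact: ler_norm.
Qed.

(** Multiplied by [cexp (- (u / N))], the base is within [O(1 / N ^ 2)] of 1, so its N-th power is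
    within [O(1 / N)] of 1. *)
Lemma ccvg_expr_div (R : realType) (u : R[i]) :
  ccvg (fun N => (1 + u / N%:R) ^+ N) (cexp u).
Proof.
have h : ccvg (fun N => ((1 + u / N%:R) * cexp (- (u / N%:R))) ^+ N) 1.
  apply: ccvg_dist; set t := fun N : nat => 25 * cabs u ^+ 2 / N%:R : R.
  have t0 : t @ \oo --> (0 : R) by exact: cvg_divn0.
  apply: (@squeeze_cvgr _ _ _ _ (cst 0) (fun N => t N * expR (t N))).
  - have [K hK] := @near_divn_le R (cabs u) 1 ltr01; exists K => // N /= /hK[N0 hN].
    rewrite cabs_ge0 /= -cabsN opprB; apply: cabs_exprB1.
    have x0 : 0 < N%:R :> R by rewrite ltr0n.
    have := @cabs_prod1 R (u / N%:R); rewrite cabsM cabsV cabs_nat => /(_ hN) hz.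
    rewrite mulrC -ler_pdivlMr //; apply: (le_trans hz).
    by rewrite /t le_eqVlt; apply/orP; left; apply/eqP; field; lra.
  - exact: cvg_cst.
  - rewrite -[X in _ --> X](mul0r (expR 0)); apply: cvgM => //.
    apply: (@continuous_cvg _ _ _ _ _ t (@expR R)) => //; exact: continuous_expR.
have := ccvgM h (@ccvg_cst R (cexp u)); rewrite mul1r; apply: ccvg_near.
exists 1%N => // N /= N0; rewrite exprMn -mulrA -cexp_mulnr -cexpD.
rewrite (_ : _ + u = 0) ?cexp0 ?mulr1 //; field.
by rewrite pnatr_eq0 -lt0n.
Qed.

(** * The functions Gamma and G *)

(** Brings factorials and integer powers under a single [cexp], where identities are checked on
    exponents. *)
Lemma nat_cexp (R : realType) k : (0 < k)%N -> (k%:R : R[i]) = cexp (ln (k%:R : R))%:C.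
Proof. by move=> k0; rewrite cexp_ln ?ltr0n // rmorph_nat. Qed.

Lemma ccvg_divn (R : realType) (a : R[i]) : ccvg (fun N => a / N%:R) 0.
Proof.
rewrite -(mulr0 a); apply: ccvgM; first exact: ccvg_cst.
rewrite [X in ccvg X](_ : _ = fun N => (1 / N%:R : R)%:C).
  by apply: ccvg_real; exact: cvg_divn0.
by apply/funext => N; rewrite mul1r fmorphV rmorph_nat.
Qed.

Lemma ccvg_1Ddivn (R : realType) (a : R[i]) : ccvg (fun N => 1 + a / N%:R) 1.
Proof. by rewrite -[X in ccvg _ X]addr0; apply: ccvgD; [exact: ccvg_cst|exact: ccvg_divn]. Qed.

(* [z] is not a nonpositive integer: neither a pole of Gamma nor a zero of G. *)
Definition not_npint (R : realType) (z : R[i]) := forall k : nat, z != - k%:R.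

Lemma not_npintD (R : realType) (z : R[i]) n : not_npint z -> not_npint (z + n%:R).
Proof.
move=> hz k; apply: contra (hz (k + n)%N) => /eqP h.
by rewrite natrD opprD -h addrK.
Qed.

Lemma not_npint_neq0 (R : realType) (z : R[i]) n : not_npint z -> z + n%:R != 0.
Proof. by move=> /(_ n); rewrite addr_eq0. Qed.

Lemma not_npint_1Ddiv (R : realType) (z : R[i]) k :
  not_npint z -> (0 < k)%N -> 1 + z / k%:R != 0.
Proof.
move=> hz k0; have k0' : k%:R != 0 :> R[i] by rewrite pnatr_eq0 -lt0n.
have := not_npint_neq0 k hz; apply: contra => /eqP e.
by rewrite -[z](divfK k0') -[X in _ + X]mul1r -mulrDl addrC e mul0r.
Qed.

Lemma prodr_neq0 (F : idomainType) a b (f : nat -> F) :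
  (forall k, (a <= k < b)%N -> f k != 0) -> \prod_(a <= k < b) f k != 0.
Proof.
move=> hf; rewrite big_nat prodf_seq_neq0; apply/allP => k.
by rewrite mem_index_iota => kab; rewrite kab hf.
Qed.

Lemma not_npint_pos (R : realType) (x : R) : 0 < x -> not_npint x%:C.
Proof.
move=> x0 k; apply/eqP => /(congr1 (@complex.Re R)) /=.
rewrite -[k%:R](rmorph_nat (real_complex R)) /= => h.
by have := ler0n R k; lra.
Qed.

Definition euler_seq (R : realType) (z : R[i]) N : R[i] :=
  N`!%:R * cpow N%:R z / \prod_(0 <= k < N.+1) (z + k%:R).

Lemma prod_addn (R : realType) (z : R[i]) N :
  \prod_(1 <= k < N.+1) (z + k%:R) = N`!%:R * \prod_(1 <= k < N.+1) (1 + z / k%:R).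
Proof.
rewrite fact_prod natr_prod -big_split /=; apply: eq_big_nat => k /andP[k0 _].
by field; rewrite pnatr_eq0 -lt0n.
Qed.

(** Weierstrass's product at finite level: the factors [cexp (- (z / k))] make the product converge,
    and the harmonic sum that compensates them is tamed by the [ln N] of [cpow N z]. *)
Lemma euler_seqE (R : realType) (z : R[i]) N : not_npint z ->
  euler_seq z N = z^-1 * cexp (- z * (\sum_(1 <= k < N.+1) k%:R^-1 - ln N%:R)%:C) *
    (\prod_(1 <= k < N.+1) ((1 + z / k%:R) * cexp (- (z / k%:R))))^-1.
Proof.
move=> hz; rewrite /euler_seq big_nat_recl // addr0.
rewrite -(big_add1 _ _ 0 N.+1 predT (fun k => z + k%:R)) prod_addn.
rewrite big_split /= -cexp_sum sumrN -mulr_sumr.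
have -> : \sum_(1 <= k < N.+1) (k%:R^-1 : R[i]) = (\sum_(1 <= k < N.+1) k%:R^-1 : R)%:C.
  by rewrite rmorph_sum; apply: eq_bigr => k _; rewrite fmorphV rmorph_nat.
set H := \sum_(_ <= _ < _) _; rewrite /cpow [(H - _)%:C]rmorphB.
set l := (ln _)%:C; set h := (H%:C); set p := \prod_(_ <= _ < _) _.
have -> : - z * (h - l) = z * l + - (z * h) by ring.
rewrite cexpD.
have p0 : p != 0.
  by apply: prodr_neq0 => k /andP[k0 _]; exact: not_npint_1Ddiv.
have z0 : z != 0 by have := not_npint_neq0 0 hz; rewrite addr0.
have N0 : N`!%:R != 0 :> R[i] by rewrite pnatr_eq0 -lt0n fact_gt0.
by field; rewrite p0 z0 N0 cexp_neq0.
Qed.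

Lemma ccvg_euler_seq (R : realType) (z : R[i]) : not_npint z ->
  Gamma z != 0 /\ ccvg (euler_seq z) (Gamma z).
Proof.
move=> hz; suff [l l0 hl] : exists2 l, l != 0 & ccvg (euler_seq z) l.
  by have -> : Gamma z = l by exact: ccvg_clim.
pose v k := (1 + z / k%:R) * cexp (- (z / k%:R)).
have [K hK] := @near_divn_le R (cabs z) 1 ltr01.
have [||l l0 hl] := @ccvg_prod_neq0 R v (25 * cabs z ^+ 2) K.
- move=> k /hK[k0 hk]; have := @cabs_prod1 R (z / k%:R).
  have -> : cabs (z / k%:R) = cabs z / k%:R by rewrite cabsM cabsV cabs_nat.
  by move=> /(_ hk) h; rewrite -mulrA -expr_div_n.
- move=> k k0; rewrite mulf_neq0 ?cexp_neq0 //.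
  exact: not_npint_1Ddiv.
have z0 : z != 0 by have := not_npint_neq0 0 hz; rewrite addr0.
exists (z^-1 * cexp (- z * (euler_gamma : R)%:C) * l^-1).
  by apply: mulf_neq0; [apply: mulf_neq0|]; rewrite ?invr_eq0 // cexp_neq0.
rewrite [X in ccvg X](funext (fun N => euler_seqE N hz)).
apply: ccvgM; last exact: ccvgV.
apply: ccvgM; first exact: ccvg_cst.
by apply: ccvg_cexp_real; exact: cvg_euler_gamma.
Qed.

Lemma Gamma_neq0 (R : realType) (z : R[i]) : not_npint z -> Gamma z != 0.
Proof. by move=> /ccvg_euler_seq[]. Qed.

(** At index N the equation holds up to the factor [1 + (1 + z) / N], which comes from shifting the
    [N + 1] linear factors by one. *)
Lemma GammaS (R : realType) (z : R[i]) : not_npint z -> Gamma (1 + z) = z * Gamma z.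
Proof.
move=> hz; have hz1 : not_npint (1 + z) by rewrite addrC; exact: (not_npintD 1).
have [_ h1] := ccvg_euler_seq hz1; have [_ h] := ccvg_euler_seq hz.
apply: (ccvg_unique h1).
have : ccvg (fun N => z * euler_seq z N * (1 + (1 + z) / N%:R)^-1) (z * Gamma z * 1^-1).
  apply: (ccvgM (ccvgM (@ccvg_cst R z) h)).
  by apply: ccvgV; [exact: oner_neq0|exact: ccvg_1Ddivn].
rewrite invr1 mulr1; apply: ccvg_near; exists 1%N => // N /= N0.
have NR : N%:R != 0 :> R[i] by rewrite pnatr_eq0 -lt0n.
rewrite /euler_seq /cpow [(1 + z) * _%:C]mulrDl mul1r cexpD cexp_ln ?ltr0n // rmorph_nat.
have e : (\prod_(0 <= k < N.+1) (z + k%:R)) * (1 + z + N%:R) =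
    z * \prod_(0 <= k < N.+1) (1 + z + k%:R).
  rewrite big_nat_recl // addr0 -mulrA; congr (_ * _).
  rewrite [RHS]big_nat_recr //=; congr (_ * _).
  by apply: eq_bigr => k _; rewrite -natr1; ring.
have p0 : \prod_(0 <= k < N.+1) (z + k%:R) != 0.
  by apply: prodr_neq0 => k _; exact: not_npint_neq0.
have p1 : \prod_(0 <= k < N.+1) (1 + z + k%:R) != 0.
  by apply: prodr_neq0 => k _; exact: not_npint_neq0.
have q1 : 1 + z + N%:R != 0 by exact: not_npint_neq0.
have q2 : N%:R + (1 + z) != 0 by rewrite addrC.
move: e p0 p1; set P := \prod_(_ <= _ < _) _; set Q := \prod_(_ <= _ < _) _ => e p0 p1.
have z0 : z != 0 by have := not_npint_neq0 0 hz; rewrite addr0.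
have -> : Q = P * (1 + z + N%:R) / z by rewrite e; field.
by field; rewrite p0 NR z0 ?q1 ?q2.
Qed.

(** * Gauss's multiplication formula *)

(** Reindexing by the Euclidean division of [j] by [n]. *)
Lemma prodr_interleave (R : comNzRingType) (f : nat -> R) n M :
  \prod_(0 <= l < n) \prod_(0 <= k < M) f (n * k + l)%N = \prod_(0 <= j < n * M) f j.
Proof.
elim: M => [|M IH]; first by rewrite muln0 big_nil big1 // => l _; rewrite big_nil.
rewrite [(n * M.+1)%N]mulnS [(n + _)%N]addnC [RHS](big_cat_nat (leq0n (n * M))) ?leq_addr //= -IH.
rewrite -{1}[(n * M)%N]add0n big_addn addKn -big_split /=.
by apply: eq_bigr => l _; rewrite big_nat_recr //= addnC.
Qed.

(** If [n z = - k], dividing [k] by [n] with remainder [l] puts [z + l / n] at minus the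
    quotient. *)
Lemma not_npint_mulrn (R : realType) (z : R[i]) n : (0 < n)%N ->
  (forall l, (l < n)%N -> not_npint (z + l%:R / n%:R)) -> not_npint (n%:R * z).
Proof.
move=> n0 hz k; apply/eqP => h; have n0' : n%:R != 0 :> R[i] by rewrite pnatr_eq0 -lt0n.
have /eqP := hz (k %% n)%N (ltn_pmod k n0) (k %/ n)%N; apply.
apply: (mulfI n0'); rewrite mulrDr h {1}(divn_eq k n) natrD natrM.
by field.
Qed.

Lemma sum_divn (R : realType) (z : R[i]) n : (0 < n)%N ->
  \sum_(0 <= l < n) (z + l%:R / n%:R) = n%:R * z + (n%:R - 1) / 2.
Proof.
move=> n0; have n0' : n%:R != 0 :> R[i] by rewrite pnatr_eq0 -lt0n.
rewrite big_split /= sumr_const_nat subn0 -mulr_suml -natr_sum -[z *+ n]mulr_natl.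
congr (_ + _); rewrite bin2_sum.
have -> : ('C(n, 2)%:R : R[i]) = n%:R * (n%:R - 1) / 2.
  have h : ('C(n, 2)%:R * 2 : R[i]) = n%:R * (n%:R - 1).
    rewrite -natrM -[X in (_ * X)%N]/(2`!)%N bin_ffact !ffactnS ffactn0 muln1 natrM.
    by case: (n) n0 => // k _; rewrite -natr1 addrK.
  by rewrite -h; field.
by field.
Qed.

Lemma stirlingE (R : realType) N :
  (ln (N`!%:R : R))%:C = (stirling R N)%:C + (N%:R + 2^-1) * (ln (N%:R : R))%:C - N%:R.
Proof.
have h2 : 2^-1 = (2^-1 : R)%:C by rewrite fmorphV /= rmorph_nat.
rewrite h2 -[N%:R in RHS](rmorph_nat (real_complex R)) -!(rmorphD, rmorphM, rmorphB) /=.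
congr (_%:C); rewrite /stirling; ring.
Qed.

(** Compares the numerators in Gauss's formula: [N! ^ n] (the big product covers the factorial only)
    against [(n N)!], with [stirling] recording the discrepancy. *)
Lemma prod_euler_seq_quot (R : realType) (z : R[i]) n N : (0 < n)%N -> (0 < N)%N ->
  \prod_(0 <= l < n) N`!%:R * cpow N%:R (n%:R * z + (n%:R - 1) / 2) * n%:R ^+ (n * N.+1)
    = (n * N)`!%:R * cpow (n * N)%:R (n%:R * z) * (n * N)%:R ^+ n.-1 *
      cexp ((n%:R * stirling R N - stirling R (n * N))%:C) *
      cpow n%:R (2^-1 - n%:R * z).
Proof.
move=> n0 N0; have nN0 : (0 < n * N)%N by rewrite muln_gt0 n0.
have eX k e : (0 < k)%N -> k%:R ^+ e = cexp ((ln (k%:R : R))%:C * e%:R) :> R[i].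
  by move=> k0; rewrite cexp_mulnr -nat_cexp.
rewrite prodr_const_nat subn0 (eX N`!) ?fact_gt0 // (eX n) // (eX (n * N)%N) //.
rewrite [in RHS]nat_cexp ?fact_gt0 // /cpow -!cexpD.
congr cexp; rewrite !stirlingE.
have -> : (n%:R * stirling R N - stirling R (n * N))%:C =
    n%:R * (stirling R N)%:C - (stirling R (n * N))%:C :> R[i].
  by rewrite rmorphB rmorphM rmorph_nat.
have -> : ln (n * N)%:R = ln n%:R + ln N%:R :> R by rewrite natrM lnM ?posrE ?ltr0n.
rewrite !natrM [(ln _ + _)%:C]rmorphD -(@natr1 _ N).
have -> : n.-1%:R = n%:R - 1 :> R[i] by case: (n) n0 => // k _; rewrite -natr1 addrK.
by field.
Qed.

Lemma prod_euler_seq (R : realType) (z : R[i]) n N : (0 < n)%N -> (0 < N)%N ->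
  (forall l, (l < n)%N -> not_npint (z + l%:R / n%:R)) ->
  \prod_(0 <= l < n) euler_seq (z + l%:R / n%:R) N =
    euler_seq (n%:R * z) (n * N) *
    (cexp ((n%:R * stirling R N - stirling R (n * N))%:C) *
      cpow n%:R (2^-1 - n%:R * z)) *
    (\prod_(1 <= i < n) (1 + ((n%:R * z + i%:R) / n%:R) / N%:R))^-1.
Proof.
move=> n0 N0 hz; have nR : n%:R != 0 :> R[i] by rewrite pnatr_eq0 -lt0n.
have NR : N%:R != 0 :> R[i] by rewrite pnatr_eq0 -lt0n.
have hnz := not_npint_mulrn n0 hz.
rewrite /euler_seq big_split [X in X * _ = _]big_split /= prodfV.
have -> : \prod_(0 <= l < n) cpow N%:R (z + l%:R / n%:R) =
    cpow N%:R (n%:R * z + (n%:R - 1) / 2) :> R[i].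
  by rewrite /cpow -cexp_sum -mulr_suml sum_divn.
have -> : \prod_(0 <= l < n) \prod_(0 <= k < N.+1) (z + l%:R / n%:R + k%:R) =
    (\prod_(0 <= j < (n * N).+1) (n%:R * z + j%:R)) *
    (\prod_(1 <= i < n) (1 + ((n%:R * z + i%:R) / n%:R) / N%:R)) *
    (n * N)%:R ^+ n.-1 / n%:R ^+ (n * N.+1).
  transitivity (\prod_(0 <= l < n) \prod_(0 <= k < N.+1)
      ((n%:R * z + (n * k + l)%:R) / n%:R)).
    apply: eq_bigr => l _; apply: eq_bigr => k _; rewrite natrD natrM.
    by field.
  rewrite (prodr_interleave (fun j => (n%:R * z + j%:R) / n%:R)).
  rewrite big_split /= prodr_const_nat subn0 exprVn; congr (_ / _).
  have nNn : ((n * N).+1 <= n * N.+1)%N by rewrite mulnS addnC -addn1 leq_add2l.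
  (* There are [n (N + 1)] linear factors, but [euler_seq (n z) (n N)] has only [n N + 1]. The other
     [n - 1] are normalized by [n N] into factors that tend to 1. *)
  rewrite (big_cat_nat (leq0n (n * N).+1) nNn) /= -mulrA; congr (_ * _).
  rewrite -[(n * N).+1]add1n big_addn mulnS addnK.
  have -> : (n * N)%:R ^+ n.-1 = \prod_(1 <= i < n) (n * N)%:R :> R[i].
    by rewrite prodr_const_nat subn1.
  rewrite -big_split /=; apply: eq_bigr => i _; rewrite natrD natrM.
  by field; rewrite nR NR.
have m0 : (n%:R : R[i]) ^+ (n * N.+1) != 0 by rewrite expf_neq0.
have w0 : ((n * N)%:R : R[i]) ^+ n.-1 != 0 by rewrite expf_neq0 // natrM mulf_neq0.
have := prod_euler_seq_quot z n0 N0; rewrite !invfM invrK.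
set P := (\prod_(0 <= j < (n * N).+1) _)^-1; set B := (\prod_(1 <= i < n) _)^-1.
move: w0; set W := (n * N)%:R ^+ n.-1; set M := n%:R ^+ _.
set c := cpow N%:R _; set A := \prod_(0 <= l < n) _ => w0 Q.
transitivity (A * c * M * (P * B / W)); first by ring.
by rewrite Q; field.
Qed.

Lemma Gamma_mult (R : realType) (z : R[i]) n : (0 < n)%N ->
  (forall l, (l < n)%N -> not_npint (z + l%:R / n%:R)) ->
  \prod_(0 <= l < n) Gamma (z + l%:R / n%:R) =
    cpow (2 * pi) ((n%:R - 1) / 2) * cpow n%:R (2^-1 - n%:R * z) * Gamma (n%:R * z).
Proof.
move=> n0 hz.
have h1 : ccvg (fun N => \prod_(0 <= l < n) euler_seq (z + l%:R / n%:R) N)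
    (\prod_(0 <= l < n) Gamma (z + l%:R / n%:R)).
  by apply: ccvg_prod => l ln; have [] := ccvg_euler_seq (hz l ln).
apply: (ccvg_unique h1).
have nN N : (N <= n * N)%N by rewrite leq_pmull.
have [_ h2] := ccvg_euler_seq (not_npint_mulrn n0 hz).
have h2' := ccvg_comp nN h2.
have h3 : ccvg (fun N => \prod_(1 <= i < n) (1 + ((n%:R * z + i%:R) / n%:R) / N%:R)) 1.
  rewrite [X in ccvg _ X](_ : _ = \prod_(0 <= i < n.-1) 1); last by rewrite big1.
  rewrite [X in ccvg X](_ : _ = fun N => \prod_(0 <= i < n.-1)
     (1 + ((n%:R * z + i.+1%:R) / n%:R) / N%:R)); last first.
    by apply/funext => N; rewrite big_add1.
  by apply: ccvg_prod => i _; exact: ccvg_1Ddivn.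
(* Both [stirling] terms tend to [ln (2 pi) / 2]; the difference of their weights, [n - 1], yields
   the power of [2 pi]. *)
pose t N : R := n%:R * stirling R N - stirling R (n * N).
have ht : t @ \oo --> (n%:R * (ln (2 * pi) / 2) - ln (2 * pi) / 2 : R).
  apply: cvgB; first by apply: cvgM; [exact: cvg_cst|exact: cvg_stirling].
  apply: (cvg_comp _ _ _ (@cvg_stirling R)) => A [N _ NA]; exists N => // k /= Nk.
  by apply: NA => /=; exact: leq_trans (nN k).
have h4 := @ccvg_cexp_real R 1 t _ ht.
have h5 := ccvgM (ccvgM h2' (ccvgM h4 (@ccvg_cst R (cpow n%:R (2^-1 - n%:R * z)))))
   (ccvgV (oner_neq0 _) h3).
rewrite invr1 mulr1 in h5.
have -> : cpow (2 * pi) ((n%:R - 1) / 2) =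
    cexp (1 * (n%:R * (ln (2 * pi) / 2) - ln (2 * pi) / 2 : R)%:C).
  rewrite /cpow; congr cexp; rewrite mul1r rmorphB rmorphM rmorph_nat rmorphM /= fmorphV rmorph_nat.
  by field.
rewrite mulrC; apply: ccvg_near h5; exists 1%N => // N /= N0.
by rewrite (prod_euler_seq n0 N0 hz) mul1r.
Qed.

(** * The canonical product of G and its functional equation *)

Definition barnes_seq (R : realType) (w : R[i]) N : R[i] :=
  \prod_(1 <= k < N.+1) ((1 + w / k%:R) ^+ k * cexp (w ^+ 2 / (2 * k%:R) - w)).

(** The base of the k-th factor is within [T / k ^ 3] of 1, so its k-th power is within
    [T * expR T / k ^ 2]. *)
Lemma ccvg_barnes_seq (R : realType) (z : R[i]) : not_npint z ->
  exists2 l, l != 0 & ccvg (barnes_seq (z - 1)) l.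
Proof.
move=> hz; set w := z - 1.
have [K hK] := @near_divn_le R (cabs w) 2^-1 ltac:(by rewrite invr_gt0).
pose T : R := 200 * cabs w ^+ 3.
have T0 : 0 <= T by rewrite mulr_ge0 ?exprn_ge0 ?cabs_ge0.
apply: (@ccvg_prod_neq0 R _ (T * expR T) K) => k.
- move=> /hK[k0 hk]; have kR : k%:R != 0 :> R[i] by rewrite pnatr_eq0 -lt0n.
  have kR1 : 1 <= k%:R :> R by rewrite ler1n.
  have -> : (1 + w / k%:R) ^+ k * cexp (w ^+ 2 / (2 * k%:R) - w) =
      ((1 + w / k%:R) * cexp ((w / k%:R) ^+ 2 / 2 - w / k%:R)) ^+ k.
    by rewrite exprMn -cexp_mulnr; congr (_ * cexp _); field.
  have e : cabs (w / k%:R) = cabs w / k%:R by rewrite cabsM cabsV cabs_nat.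
  have := @cabs_prod2 R (w / k%:R); rewrite e => /(_ hk) h.
  have k2 : 0 < k%:R ^+ 2 :> R by rewrite exprn_gt0 //; lra.
  have ht : k%:R * cabs ((1 + w / k%:R) * cexp ((w / k%:R) ^+ 2 / 2 - w / k%:R) - 1)
      <= T / k%:R ^+ 2.
    rewrite mulrC -ler_pdivlMr; last by lra.
    apply: (le_trans h); rewrite le_eqVlt; apply/orP; left; apply/eqP.
    by rewrite /T; field; lra.
  apply: (le_trans (cabs_exprB1 ht)); rewrite [leRHS]mulrAC ler_pM //.
  + by rewrite divr_ge0 ?(ltW k2).
  + rewrite ler_expR ler_pdivrMr // ler_peMr //; last by rewrite exprn_ege1.
- move=> k0; rewrite mulf_neq0 ?cexp_neq0 // expf_neq0 //.
  have kR : k%:R != 0 :> R[i] by rewrite pnatr_eq0 -lt0n.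
  (* Since [1 + w / k = (z + (k - 1)) / k], the k-th factor vanishes only at [z = - (k - 1)]. *)
  have := not_npint_neq0 k.-1 hz; apply: contra => /eqP h.
  apply/eqP; rewrite -[RHS](mul0r k%:R) -h mulrDl divfK // /w.
  by rewrite -[in RHS](prednK k0) -natr1; ring.
Qed.

Lemma barnesG_cvg (R : realType) (z : R[i]) : not_npint z ->
  barnesG z != 0 /\ ccvg (fun N => cpow (2 * pi) ((z - 1) / 2)
    * cexp (- ((z - 1) + (1 + (euler_gamma : R)%:C) * (z - 1) ^+ 2) / 2)
    * barnes_seq (z - 1) N) (barnesG z).
Proof.
move=> /ccvg_barnes_seq[l l0 hl].
have -> : barnesG z = cpow (2 * pi) ((z - 1) / 2)
    * cexp (- ((z - 1) + (1 + (euler_gamma : R)%:C) * (z - 1) ^+ 2) / 2) * l.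
  by rewrite /barnesG; congr (_ * _); exact: ccvg_clim.
split; first by apply: mulf_neq0 => //; apply: mulf_neq0; exact: cexp_neq0.
exact: (ccvgM (@ccvg_cst R _) hl).
Qed.

Lemma barnesG_neq0 (R : realType) (z : R[i]) : not_npint z -> barnesG z != 0.
Proof. by move=> /barnesG_cvg[]. Qed.

(** The quotients [((z + k) / (z + k - 1)) ^ k] multiply to [(z + N) ^ N] over the product of the
    [z + k] with [k < N]. The exponents differ by [(z - 1/2) / k - 1], whence the harmonic sum and
    the [- N]. *)
Lemma barnes_seqS (R : realType) (z : R[i]) N : not_npint z ->
  barnes_seq z N = barnes_seq (z - 1) N *
    ((z + N%:R) ^+ N / \prod_(0 <= k < N) (z + k%:R)) *
    cexp ((z - 2^-1) * (\sum_(1 <= k < N.+1) k%:R^-1 : R)%:C - N%:R).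
Proof.
move=> hz; elim: N => [|N IH].
  by rewrite /barnes_seq !big_nil mulr0 subr0 cexp0 expr0 divr1 !mulr1.
rewrite /barnes_seq big_nat_recr //= -/(barnes_seq z N) IH [in RHS]big_nat_recr //=.
rewrite -/(barnes_seq (z - 1) N) [in RHS]big_nat_recr //= [in RHS]big_nat_recr //=.
have P0 : \prod_(0 <= k < N) (z + k%:R) != 0.
  by apply: prodr_neq0 => k _; exact: not_npint_neq0.
have N0 := not_npint_neq0 N hz.
have k0 : N.+1%:R != 0 :> R[i] by rewrite pnatr_eq0.
rewrite rmorphD /= fmorphV rmorph_nat.
set H := (\sum_(_ <= _ < _) _)%:C; set P := \prod_(_ <= _ < _) _ in P0 *.
set B := barnes_seq _ _.
have -> : 1 + z / N.+1%:R = (z + N.+1%:R) / N.+1%:R by field.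
have -> : 1 + (z - 1) / N.+1%:R = (z + N%:R) / N.+1%:R.
  by rewrite -[in LHS](@natr1 _ N); field; rewrite nat1r.
rewrite !expr_div_n [(z + N%:R) ^+ N.+1]exprSr.
have e : cexp (z ^+ 2 / (2 * N.+1%:R) - z) * cexp ((z - 2^-1) * H - N%:R) =
    cexp ((z - 1) ^+ 2 / (2 * N.+1%:R) - (z - 1)) * cexp ((z - 2^-1) * (H + N.+1%:R^-1) - N.+1%:R).
  rewrite -!cexpD; congr cexp; rewrite -(@natr1 _ N); field.
  by rewrite natr1.
set E := cexp (z ^+ 2 / _ - z) in e *; set E' := cexp (_ - N%:R) in e *.
transitivity (B * ((z + N%:R) ^+ N / P) * ((z + N.+1%:R) ^+ N.+1 / N.+1%:R ^+ N.+1) * (E * E')).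
  by ring.
rewrite e; field; rewrite P0 N0 !expf_neq0 //.
Qed.

Lemma barnesGS (R : realType) (z : R[i]) : not_npint z ->
  barnesG (z + 1) = Gamma z * barnesG z.
Proof.
move=> hz; have hz1 : not_npint (z + 1) by exact: (not_npintD 1).
have [_ h1] := barnesG_cvg hz1; have [_ h] := barnesG_cvg hz.
have [_ hG] := ccvg_euler_seq hz; rewrite addrK in h1; apply: (ccvg_unique h1).
set g : R[i] := (euler_gamma : R)%:C in h h1.
have hH := @ccvg_cexp_real R (z - 2^-1) _ _ (@cvg_euler_gamma R).
have hS := @ccvg_cexp_real R (-1) _ _ (@cvg_stirling R).
(* The extra factor [1 + z / N] accounts for the [N + 1] linear factors of [euler_seq], against [N]
   in [barnes_seqS]. *)
have he := ccvgM (@ccvg_expr_div R z) (@ccvg_1Ddivn R z).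
(* The constant is the quotient of the prefactors of [G (z + 1)] and [G z]; it is inverse to the
   product of the limits in [he], [hH] and [hS]. *)
have := ccvgM (@ccvg_cst R (cpow (2 * pi) 2^-1 * cexp (- z - g * (z - 2^-1))))
  (ccvgM (ccvgM (ccvgM hG h) he) (ccvgM hH hS)).
have -> : cpow (2 * pi) 2^-1 * cexp (- z - g * (z - 2^-1)) *
  (Gamma z * barnesG z * (cexp z * 1) * (cexp ((z - 2^-1) * (euler_gamma : R)%:C) *
     cexp (-1 * (ln (2 * pi) / 2 : R)%:C))) = Gamma z * barnesG z.
  rewrite -/g /cpow; have -> : (ln (2 * pi) / 2 : R)%:C = 2^-1 * (ln (2 * pi) : R)%:C.
    by rewrite mulrC rmorphM /= fmorphV rmorph_nat.
  set l := (ln _)%:C.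
  have e : cexp (2^-1 * l) * cexp (- z - g * (z - 2^-1)) * cexp z *
      cexp ((z - 2^-1) * g) * cexp (-1 * (2^-1 * l)) = 1.
    by rewrite -!cexpD -[RHS](@cexp0 R); congr cexp; ring.
  by rewrite -[RHS]mul1r -[X in _ = X * _]e; ring.
apply: ccvg_near; exists 1%N => // N /= N0.
have NR : N%:R != 0 :> R[i] by rewrite pnatr_eq0 -lt0n.
rewrite (barnes_seqS N hz) /euler_seq [\prod_(0 <= k < N.+1) _]big_nat_recr //=.
have P0 : \prod_(0 <= k < N) (z + k%:R) != 0.
  by apply: prodr_neq0 => k _; exact: not_npint_neq0.
have zN := not_npint_neq0 N hz.
have -> : (1 + z / N%:R) ^+ N = (z + N%:R) ^+ N / N%:R ^+ N.
  by rewrite -expr_div_n; congr (_ ^+ _); field.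
set L := (ln (N%:R : R))%:C; set S := (stirling R N)%:C.
have e1 : N`!%:R / (N%:R ^+ N * N%:R) =
    cexp (S + (N%:R + 2^-1) * L - N%:R - (L * N%:R + L)) :> R[i].
  rewrite cexpD -cexpV [cexp (_ * _ + L)]cexpD cexp_mulnr /S /L.
  by rewrite -stirlingE -!nat_cexp // fact_gt0.
rewrite -/g [(_ - ln _)%:C]rmorphB /= -/L; set H := (\sum_(_ <= _ < _) _)%:C.
set c1 := cpow (2 * pi) 2^-1; set c2 := cexp (- z - _).
set c3 := cpow _ ((z - 1) / 2); set c4 := cexp (- (z - 1 + _) / 2).
set c5 := cexp (_ * (H - L)); set c6 := cexp (- 1 * S).
have e : c1 * c2 * (N`!%:R / (N%:R ^+ N * N%:R)) * cpow N%:R z * c3 * c4 * c5 * c6 =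
    cpow (2 * pi) (z / 2) * cexp (- (z + (1 + g) * z ^+ 2) / 2) *
    cexp ((z - 2^-1) * H - N%:R).
  rewrite e1 /c1 /c2 /c3 /c4 /c5 /c6 /cpow -/L -!cexpD; congr cexp.
  by field.
set B := barnes_seq _ _; set P := \prod_(_ <= _ < _) _ in P0 *; set V := _ ^+ N.
rewrite -[RHS](_ : B * (V / P) * (cpow (2 * pi) (z / 2) *
  cexp (- (z + (1 + g) * z ^+ 2) / 2) * cexp ((z - 2^-1) * H - N%:R)) = _); last by ring.
rewrite -e; field; rewrite P0 zN NR expf_neq0 //.
Qed.

(** * Products of quotients of G *)

(** Raising [j] by [m] adds 1 to the argument, so [j] reduces to its representative
    [(j - 1) %% m + 1] between 1 and [m]. *)
Lemma not_npint_addr_divn (R : realType) (a : R[i]) m j : (0 < m)%N ->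
  (forall i, (1 <= i <= m)%N -> not_npint (a + i%:R / m%:R)) ->
  (0 < j)%N -> not_npint (a + j%:R / m%:R).
Proof.
move=> m0 ha j0; have mR : m%:R != 0 :> R[i] by rewrite pnatr_eq0 -lt0n.
have hi : (1 <= (j.-1 %% m).+1 <= m)%N by rewrite ltn_pmod.
have := not_npintD (j.-1 %/ m) (ha _ hi); congr (not_npint _).
rewrite -addrA; congr (_ + _); rewrite -[in RHS](prednK j0) {3}(divn_eq j.-1 m).
by rewrite -!natr1 natrD natrM; field.
Qed.

Lemma prod_barnesG_quot (R : realType) (a : R[i]) m p : (0 < m)%N ->
  (forall j, (0 < j)%N -> not_npint (a + j%:R / m%:R)) ->
  \prod_(1 <= j < m.+1) (barnesG (a + (j + p)%:R / m%:R) / barnesG (a + j%:R / m%:R))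
    = \prod_(1 <= q < p.+1) Gamma (a + q%:R / m%:R).
Proof.
move=> m0 ha; have mR : m%:R != 0 :> R[i] by rewrite pnatr_eq0 -lt0n.
elim: p => [|p IH].
  rewrite [RHS]big_nil big_nat big1 // => j /andP[j0 _].
  by rewrite addn0 divff // barnesG_neq0 //; exact: ha.
rewrite [RHS]big_nat_recr //= -IH mulrC.
pose f k := barnesG (a + (k + p)%:R / m%:R).
have f0 k : (0 < k)%N -> f k != 0.
  by move=> k0; apply/barnesG_neq0/ha; rewrite addn_gt0 k0.
(* The product collapses to [f (m + 1) / f 1], whose two arguments differ by exactly 1. *)
have -> : Gamma (a + p.+1%:R / m%:R) = \prod_(1 <= j < m.+1) (f j.+1 / f j).
  rewrite telescope_prodf // => [|k /andP[k1 _]]; last by rewrite f0 // ltnW.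
  have := barnesGS (ha p.+1 isT); rewrite -addrA.
  have -> : p.+1%:R / m%:R + 1 = (m.+1 + p)%:R / m%:R :> R[i].
    by rewrite addSnnS natrD; field.
  by rewrite /f add1n => ->; rewrite mulfK // -[p.+1]add1n; exact: f0.
rewrite -big_split /= big_nat [RHS]big_nat; apply: eq_bigr => j /andP[j0 _].
by rewrite /f addnS addSn mulrA divfK //; exact: f0.
Qed.

Lemma sum_natr (R : realType) p :
  \sum_(1 <= q < p.+1) q%:R = p%:R * (1 + p%:R) / 2 :> R[i].
Proof.
elim: p => [|p IH]; first by rewrite big_nil mul0r mul0r.
by rewrite big_nat_recr //= IH -natr1; field.
Qed.

Lemma cpow_sum (R : realType) (a : R) (b c : nat) (f : nat -> R[i]) :
  \prod_(b <= k < c) cpow a (f k) = cpow a (\sum_(b <= k < c) f k).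
Proof. by rewrite /cpow mulr_suml cexp_sum. Qed.

Lemma cpowD (R : realType) (a : R) (z w : R[i]) :
  cpow a (z + w) = cpow a z * cpow a w.
Proof. by rewrite /cpow mulrDl cexpD. Qed.

Lemma cpow0 (R : realType) (a : R) : cpow a (0 : R[i]) = 1.
Proof. by rewrite /cpow mul0r cexp0. Qed.

Lemma cpow_neq0 (R : realType) (a : R) (z : R[i]) : cpow a z != 0.
Proof. exact: cexp_neq0. Qed.

Lemma prod_Gamma_barnesG (R : realType) (m n p : nat) (s : R[i]) :
  (0 < m)%N -> (0 < n)%N ->
  (forall l j, (l < n)%N -> (1 <= j <= m)%N ->
     not_npint ((s + l%:R) / n%:R + j%:R / m%:R)) ->
  \prod_(1 <= j < p.+1) Gamma (s + n%:R / m%:R * j%:R) =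
    cpow n%:R (- (p%:R / 2) + s * p%:R + n%:R * p%:R / (2 * m%:R) * (1 + p%:R))
    * cpow (2 * pi) (- (p%:R * (n%:R - 1) / 2))
    * \prod_(0 <= l < n) \prod_(1 <= j < m.+1)
        (barnesG ((s + l%:R) / n%:R + (j + p)%:R / m%:R)
         / barnesG ((s + l%:R) / n%:R + j%:R / m%:R)).
Proof.
move=> m0 n0 hs.
have mR : m%:R != 0 :> R[i] by rewrite pnatr_eq0 -lt0n.
have nR : n%:R != 0 :> R[i] by rewrite pnatr_eq0 -lt0n.
have hs' l j : (l < n)%N -> (0 < j)%N -> not_npint ((s + l%:R) / n%:R + j%:R / m%:R).
  by move=> ln j0; apply: not_npint_addr_divn => // i im; exact: hs.
have -> : \prod_(0 <= l < n) \prod_(1 <= j < m.+1)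
        (barnesG ((s + l%:R) / n%:R + (j + p)%:R / m%:R)
         / barnesG ((s + l%:R) / n%:R + j%:R / m%:R)) =
    \prod_(1 <= q < p.+1) \prod_(0 <= l < n) Gamma ((s / n%:R + q%:R / m%:R) + l%:R / n%:R).
  rewrite [RHS]exchange_big_nat /= big_nat [RHS]big_nat; apply: eq_bigr => l /andP[_ ln].
  rewrite prod_barnesG_quot //; last by move=> j j0; exact: hs'.
  by apply: eq_bigr => q _; congr Gamma; rewrite mulrDl addrAC.
have -> : \prod_(1 <= q < p.+1) \prod_(0 <= l < n)
      Gamma ((s / n%:R + q%:R / m%:R) + l%:R / n%:R) =
    \prod_(1 <= q < p.+1) (cpow (2 * pi) ((n%:R - 1) / 2) *
      cpow n%:R (2^-1 - s - n%:R / m%:R * q%:R) * Gamma (s + n%:R / m%:R * q%:R)).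
  rewrite big_nat [RHS]big_nat; apply: eq_bigr => q /andP[q0 _].
  rewrite Gamma_mult // => [|l ln]; last first.
    by have := hs' l q ln q0; rewrite mulrDl addrAC.
  have -> : n%:R * (s / n%:R + q%:R / m%:R) = s + n%:R / m%:R * q%:R.
    by field; rewrite nR mR.
  by rewrite opprD addrA.
rewrite 2!big_split /= !cpow_sum.
have -> : \sum_(1 <= k < p.+1) (n%:R - 1) / 2 = p%:R * ((n%:R - 1) / 2) :> R[i].
  by rewrite sumr_const_nat subn1 mulr_natl.
have -> : \sum_(1 <= k < p.+1) (2^-1 - s - n%:R / m%:R * k%:R) =
    p%:R * (2^-1 - s) - n%:R / m%:R * (p%:R * (1 + p%:R) / 2).
  rewrite big_split /= sumr_const_nat subn1 /= sumrN -mulr_sumr sum_natr.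
  by rewrite [p%:R * (_ - _)]mulr_natl.
set E := - (p%:R / 2) + _ + _; set F := - (p%:R * _ / 2).
set E' := _ * (_ - s) - _; set F' := _ * (_ / 2).
(* The prefactors in the statement are inverse to those that Gauss's formula yields, multiplied over
   [q]. *)
have hE : cpow n%:R E * cpow n%:R E' = 1.
  rewrite -cpowD -[RHS](cpow0 n%:R); congr cpow.
  by rewrite /E /E'; field.
have hF : cpow (2 * pi) F * cpow (2 * pi) F' = 1.
  rewrite -cpowD -[RHS](cpow0 (2 * pi)); congr cpow.
  by rewrite /F /F'; field.
move: (cpow n%:R E) (cpow n%:R E') (cpow _ F) (cpow _ F') hE hF => e e' f f' hE hF.
set G := \prod_(_ <= _ < _) _.
transitivity ((e * e') * (f * f') * G); first by rewrite hE hF !mul1r.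
by ring.
Qed.

(** * The identity with the binomial coefficient *)

Lemma prod_nat_double (F : comNzRingType) (f : nat -> F) p :
  \prod_(1 <= j < (2 * p).+1) f j =
    \prod_(1 <= j < p.+1) f j * \prod_(1 <= j < p.+1) f (j + p)%N.
Proof.
rewrite (big_cat_nat (n := p.+1)) //=; last by rewrite ltnS mul2n -addnn leq_addr.
congr (_ * _); rewrite -[X in \prod_(X <= _ < _) _]add1n big_addn.
by rewrite mul2n -addnn -addnS addKn.
Qed.

Lemma prod_barnesG_refl (R : realType) (m n p : nat) : (0 < m)%N -> (0 < n)%N ->
  \prod_(0 <= nu < n) \prod_(0 <= mu < m)
    (barnesG (p%:R / m%:R + nu%:R / n%:R - mu%:R / m%:R + 1) ^+ 2
     / (barnesG (2 * p%:R / m%:R + nu%:R / n%:R - mu%:R / m%:R + 1)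
        * barnesG (nu%:R / n%:R - mu%:R / m%:R + 1))) =
  \prod_(0 <= l < n) \prod_(1 <= j < m.+1)
     (barnesG (l%:R / n%:R + (j + p)%:R / m%:R) ^+ 2 /
       (barnesG (l%:R / n%:R + (j + 2 * p)%:R / m%:R) *
        barnesG (l%:R / n%:R + j%:R / m%:R))) :> R[i].
Proof.
move=> m0 n0; have mR : m%:R != 0 :> R[i] by rewrite pnatr_eq0 -lt0n.
have nR : n%:R != 0 :> R[i] by rewrite pnatr_eq0 -lt0n.
apply: eq_bigr => l _; rewrite big_nat_rev [RHS]big_add1 /= big_nat [RHS]big_nat.
apply: eq_bigr => j /andP[_ jm]; rewrite add0n natrB //.
rewrite [(j.+1 + p)%:R]natrD [(j.+1 + _)%:R]natrD natrM.
by congr (barnesG _ ^+ 2 / (barnesG _ * barnesG _)); field; rewrite ?mR nR.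
Qed.

(** Pulling [x * j] and [x * (j + p)] out of the Gamma values leaves the product of the
    [j / (j + p)], which is the inverse of the binomial coefficient. What remains is
    [P p ^+ 2 / P (2 * p)]. *)
Lemma Gamma_quot_barnesG (R : realType) (p m n : nat) (x : R[i]) :
  (0 < m)%N -> (0 < n)%N -> x = n%:R / m%:R ->
  'C(2 * p, p)%:R * \prod_(1 <= j < p.+1)
      (Gamma (1 + x * j%:R) / Gamma (1 + x * (j + p)%:R)) =
    cpow n%:R (- (p%:R ^+ 2 * x))
    * \prod_(0 <= l < n) \prod_(1 <= j < m.+1)
       (barnesG (l%:R / n%:R + (j + p)%:R / m%:R) ^+ 2 /
         (barnesG (l%:R / n%:R + (j + 2 * p)%:R / m%:R) *
          barnesG (l%:R / n%:R + j%:R / m%:R))).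
Proof.
move=> m0 n0 xE.
have mR : m%:R != 0 :> R[i] by rewrite pnatr_eq0 -lt0n.
have nR : n%:R != 0 :> R[i] by rewrite pnatr_eq0 -lt0n.
have x0 : x != 0 by rewrite xE mulf_neq0 ?invr_eq0.
have hpos (a b c d : nat) : (0 < b)%N -> (0 < c)%N -> (0 < d)%N ->
    not_npint (a%:R / b%:R + c%:R / d%:R : R[i]).
  move=> b0 c0 d0; have -> : a%:R / b%:R + c%:R / d%:R = (a%:R / b%:R + c%:R / d%:R : R)%:C.
    by rewrite rmorphD !rmorphM /= !fmorphV !rmorph_nat.
  by apply: not_npint_pos; rewrite ltr_wpDl ?divr_ge0 ?divr_gt0 ?ltr0n.
have hx j : (0 < j)%N -> not_npint (x * j%:R).
  move=> j0; have := hpos 0%N 1%N (n * j)%N m isT; rewrite muln_gt0 n0 j0 => /(_ isT m0).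
  by rewrite mul0r add0r natrM mulrAC -xE.
pose A q : R[i] := \prod_(0 <= l < n) \prod_(1 <= j < m.+1)
    (barnesG (l%:R / n%:R + (j + q)%:R / m%:R) / barnesG (l%:R / n%:R + j%:R / m%:R)).
pose P q := \prod_(1 <= j < q.+1) Gamma (x * j%:R).
have PA q : P q = cpow n%:R (- (q%:R / 2) + x * q%:R / 2 * (1 + q%:R))
    * cpow (2 * pi) (- (q%:R * (n%:R - 1) / 2)) * A q.
  have h : forall l j, (l < n)%N -> (1 <= j <= m)%N ->
      not_npint ((0 + l%:R) / n%:R + j%:R / m%:R : R[i]).
    by move=> l j ln /andP[j0 _]; rewrite add0r; exact: hpos.
  have := prod_Gamma_barnesG q m0 n0 h.
  have -> : \prod_(1 <= j < q.+1) Gamma (0 + n%:R / m%:R * j%:R) = P q.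
    by apply: eq_bigr => j _; rewrite add0r xE.
  move=> ->; congr (cpow _ _ * _ * _); first by rewrite xE; field.
  by apply: eq_bigr => l _; rewrite add0r.
have A0 q : A q != 0.
  apply: prodr_neq0 => l /andP[_ ln]; apply: prodr_neq0 => j /andP[j0 _].
  by rewrite mulf_neq0 ?invr_eq0 // barnesG_neq0 //; apply: hpos; rewrite // addn_gt0 j0.
have -> : \prod_(0 <= l < n) \prod_(1 <= j < m.+1)
       (barnesG (l%:R / n%:R + (j + p)%:R / m%:R) ^+ 2 /
         (barnesG (l%:R / n%:R + (j + 2 * p)%:R / m%:R) *
          barnesG (l%:R / n%:R + j%:R / m%:R))) = A p ^+ 2 / A (2 * p)%N.
  rewrite /A expr2 -prodfV -!big_split /= big_nat [RHS]big_nat; apply: eq_bigr => l /andP[_ ln].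
  rewrite -prodfV -!big_split /= big_nat [RHS]big_nat; apply: eq_bigr => j /andP[j0 _].
  have h0 : barnesG (l%:R / n%:R + j%:R / m%:R) != 0 :> R[i] by apply/barnesG_neq0/hpos.
  have h2 : barnesG (l%:R / n%:R + (j + 2 * p)%:R / m%:R) != 0 :> R[i].
    by apply/barnesG_neq0/hpos; rewrite // addn_gt0 j0.
  by field; rewrite h0 h2.
have hP : P (2 * p)%N = P p * \prod_(1 <= j < p.+1) Gamma (x * (j + p)%:R).
  exact: prod_nat_double.
have P0 q : P q != 0 by apply: prodr_neq0 => j /andP[j0 _]; apply/Gamma_neq0/hx.
have -> : \prod_(1 <= j < p.+1) (Gamma (1 + x * j%:R) / Gamma (1 + x * (j + p)%:R)) =
    (p`!%:R * p`!%:R / (2 * p)`!%:R) * (P p ^+ 2 / P (2 * p)%N).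
  have -> : \prod_(1 <= j < p.+1) (Gamma (1 + x * j%:R) / Gamma (1 + x * (j + p)%:R)) =
      \prod_(1 <= j < p.+1) (j%:R / (j + p)%:R * (Gamma (x * j%:R) / Gamma (x * (j + p)%:R))).
    rewrite big_nat [RHS]big_nat; apply: eq_bigr => j /andP[j0 _].
    have jp0 : (0 < j + p)%N by rewrite addn_gt0 j0.
    have jpR : j%:R + p%:R != 0 :> R[i] by rewrite -natrD pnatr_eq0 -lt0n.
    rewrite !GammaS; [|exact: hx|exact: hx].
    have G0 := Gamma_neq0 (hx _ jp0).
    by field; rewrite jpR x0 G0.
  have hf : (2 * p)`!%:R = p`!%:R * \prod_(1 <= j < p.+1) (j + p)%:R :> R[i].
    by rewrite !fact_prod !natr_prod prod_nat_double.
  have f0 : p`!%:R != 0 :> R[i] by rewrite pnatr_eq0 -lt0n fact_gt0.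
  have f1 : \prod_(1 <= j < p.+1) (j + p)%:R != 0 :> R[i].
    by apply: prodr_neq0 => j /andP[j0 _]; rewrite pnatr_eq0 -lt0n addn_gt0 j0.
  have g1 : \prod_(1 <= j < p.+1) Gamma (x * (j + p)%:R) != 0.
    by apply: prodr_neq0 => j /andP[j0 _]; apply/Gamma_neq0/hx; rewrite addn_gt0 j0.
  rewrite big_split [X in X * _ = _]big_split [X in _ * X = _]big_split /= !prodfV -/(P p).
  have -> : \prod_(1 <= j < p.+1) j%:R = p`!%:R :> R[i] by rewrite fact_prod natr_prod.
  rewrite hf hP.
  by field; rewrite f0 f1 g1 P0.
have -> : 'C(2 * p, p)%:R * (p`!%:R * p`!%:R / (2 * p)`!%:R * (P p ^+ 2 / P (2 * p)%N)) =
    P p ^+ 2 / P (2 * p)%N.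
  have h2p : (p <= 2 * p)%N by rewrite leq_pmull.
  have := bin_fact h2p; have -> : (2 * p - p = p)%N by rewrite mul2n -addnn addnK.
  move=> /(congr1 (fun k => k%:R : R[i])); rewrite [X in X = _]natrM [X in _ * X]natrM => <-.
  have f0 : p`!%:R != 0 :> R[i] by rewrite pnatr_eq0 -lt0n fact_gt0.
  have c0 : 'C(2 * p, p)%:R != 0 :> R[i] by rewrite pnatr_eq0 -lt0n bin_gt0.
  by field; rewrite f0 c0 P0.
rewrite !PA.
set u1 := cpow _ _; set u2 := cpow _ _; set u3 := cpow _ _; set u4 := cpow _ _; set u5 := cpow _ _.
(* Exponents linear in [p] agree between twice [p] and [2 * p], so every power of [2 pi] cancels;
   only the quadratic part leaves [- p ^ 2 * x]. *)
have e : u1 ^+ 2 * u2 ^+ 2 = u5 * (u3 * u4).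
  by rewrite !expr2 /u1 /u2 /u3 /u4 /u5 natrM /cpow -!cexpD; congr cexp; field.
have u30 : u3 != 0 by exact: cpow_neq0.
have u40 : u4 != 0 by exact: cpow_neq0.
apply: (mulIf (mulf_neq0 u30 u40)).
transitivity (u1 ^+ 2 * u2 ^+ 2 * (A p ^+ 2 / A (2 * p)%N)).
  by field; rewrite A0 u30 u40.
by rewrite e; ring.
Qed.

End GammaAndBarnes.

Theorem proposition2p2 (R : realType) :
  (forall (m n p : nat) (s : R[i]),
    (0 < m)%N -> (0 < n)%N -> (0 < p)%N ->
    (forall l j k : nat, (l < n)%N -> (1 <= j <= m)%N ->
       (s + l%:R) / n%:R + j%:R / m%:R <> - k%:R) ->
    \prod_(1 <= j < p.+1) Gamma (s + n%:R / m%:R * j%:R) =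
      cpow n%:R (- (p%:R / 2) + s * p%:R
                 + n%:R * p%:R / (2 * m%:R) * (1 + p%:R))
      * cpow (2 * pi) (- (p%:R * (n%:R - 1) / 2))
      * \prod_(0 <= l < n) \prod_(1 <= j < m.+1)
          (barnesG ((s + l%:R) / n%:R + (j + p)%:R / m%:R)
           / barnesG ((s + l%:R) / n%:R + j%:R / m%:R)))
  /\
  (forall (p : nat) (beta : R) (m n : nat),
    (0 < p)%N -> 0 < beta -> (0 < m)%N -> (0 < n)%N -> coprime m n ->
    beta / 2 = m%:R / n%:R ->
    'C(2 * p, p)%:R
      * \prod_(1 <= j < p.+1)
          (Gamma (1 + 2 * j%:R / beta%:C)
           / Gamma (1 + 2 * (j + p)%:R / beta%:C)) =
      cpow n%:R (- (2 * p%:R ^+ 2 / beta%:C))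
      * \prod_(0 <= nu < n) \prod_(0 <= mu < m)
          (barnesG (p%:R / m%:R + nu%:R / n%:R - mu%:R / m%:R + 1) ^+ 2
           / (barnesG (2 * p%:R / m%:R + nu%:R / n%:R - mu%:R / m%:R + 1)
              * barnesG (nu%:R / n%:R - mu%:R / m%:R + 1)))).
Proof.
split=> [m n p s m0 n0 _ hs|p beta m n _ beta0 m0 n0 _ hbeta].
  by apply: prod_Gamma_barnesG => // l j ln jm k; apply/eqP; exact: hs.
have mR : m%:R != 0 :> R[i] by rewrite pnatr_eq0 -lt0n.
have nR : n%:R != 0 :> R[i] by rewrite pnatr_eq0 -lt0n.
have bE : beta%:C = 2 * (m%:R / n%:R) :> R[i].
  have -> : beta = 2 * (m%:R / n%:R) by rewrite -hbeta; field.
  by rewrite !rmorphM /= fmorphV !rmorph_nat.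
have xE : 2 / beta%:C = n%:R / m%:R by rewrite bE; field; rewrite mR nR.
rewrite prod_barnesG_refl //.
have -> : - (2 * p%:R ^+ 2 / beta%:C) = - (p%:R ^+ 2 * (2 / beta%:C)) by ring.
rewrite -(Gamma_quot_barnesG p m0 n0 xE); congr (_ * _).
by apply: eq_bigr => j _; rewrite ![2 * _ / _]mulrAC.
Qed.
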